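(* Let $p:\widehat{X}\to X$ be a covering map of connected spaces determined by the normal subgroup $N$ of $F=\pi_1(X,x)$, and let $\phi:F\to G=F/N$ be the quotient morphism. Let $\widetilde{X}_0=p^{-1}(x)$, so that there is a bijection $\widetilde{X}_0\cong G=F/N$. Let $\widehat{F}$ be the pullback along $\phi:F\to G$ of the universal covering groupoid $\widetilde{G}\to G$. Then $\widehat{F}\cong\pi_1(\widehat{X},\widetilde{X}_0)$, and so there is an isomorphism $$\widehat{F}^{\mathrm{totab}}\cong H_1(\widehat{X},\widetilde{X}_0).$$ Hence there is a universal $\phi$-derivation $\pi_1(X,x)\to H_1(\widehat{X},\widetilde{X}_0)$.
   Context: Here $x$ is a point of $X$, and ''determined by $N$'' means that $p_*\pi_1(\widehat{X},\hat{x})=N$ for a point $\hat x\in p^{-1}(x)$. Composition in a groupoid is written so that for $g:p\to q$ and $h:q\to r$ the composite is $gh:p\to r$ (for path classes: first $g$, then $h$). $\pi_1(Y,B)$ denotes the fundamental groupoid of $Y$ on a set $B\subseteq Y$ of base points: objects are the points of $B$, morphisms are homotopy classes rel end points of paths in $Y$ with end points in $B$. For a groupoid $H$, the universal abelianisation $H\to H^{\mathrm{totab}}$ is the universal morphism from $H$ to an abelian group (regarded as a groupoid with one object). $H_1(\widehat X,\widetilde X_0)$ is the usual relative singular homology. The universal covering groupoid $\widetilde{G}\to G$ of the group $G$ has objects the elements of $G$ and morphisms the pairs $(g,h):gh\to h$, $g,h\in G$, with composition $(g,hk)(h,k)=(gh,k)$ and projection $(g,h)\mapsto g$. The pullback $\widehat{F}$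 has objects the elements of $G$ and morphisms the pairs $(u,g):(\phi u)g\to g$ with $u\in F$, $g\in G$. $G$ acts on the right of $\widehat{F}$ by $(u,g)^k=(u,gk)$, which makes $\widehat{F}^{\mathrm{totab}}$ a right $G$-module; $H_1(\widehat X,\widetilde X_0)$ is regarded as a right $G$-module through the isomorphism with $\widehat{F}^{\mathrm{totab}}$. For a right $G$-module $M$, a $\phi$-derivation $d:F\to M$ is a function with $d(uv)=d(u)^{\phi v}+d(v)$ for all $u,v\in F$; a $\phi$-derivation $\partial:F\to D$ is universal if for every $\phi$-derivation $d:F\to M$ there is a unique $G$-morphism $d':D\to M$ with $d'\partial=d$.
   Formalization: ''Connected spaces'' is taken to mean path-connected; for merely topologically connected spaces the bijection of the fibre with F/N can fail, e.g. for the connected double cover of the Warsaw circle. *)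

(* Defs.v *)
From HB Require Import structures.
From mathcomp Require Import all_boot all_order all_algebra.
From mathcomp Require Import generic_quotient ring_quotient.
From mathcomp Require Import all_classical all_reals topology normedtype.
From mathcomp Require Import continuous_path.
From mathcomp Require Import freeg.
From mathcomp Require Import lra.

Set Implicit Arguments.
Unset Strict Implicit.
Unset Printing Implicit Defensive.

Import Order.TTheory GRing.Theory Num.Theory.
Import numFieldNormedType.Exports.

Local Open Scope classical_set_scope.
Local Open Scope ring_scope.
Local Open Scope quotient_scope.

Definition I01 (R : realType) : Type := set_type [set t : R | 0 <= t <= 1].

HB.instance Definition _ (R : realType) := Topological.on (I01 R).

Section UnitInterval.
Context {R : realType}.
Local Notation I := (I01 R).

Lemma clamp_subproof (r : R) :
  Num.max 0 (Num.min 1 r) \in [set t : R | 0 <= t <= 1].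
Proof.
apply/mem_set; rewrite /= le_max lexx /= ge_max ler01 /=.
by rewrite ge_min lexx.
Qed.

Definition clamp (r : R) : I := exist _ (Num.max 0 (Num.min 1 r)) (clamp_subproof r).

Definition ival (t : I) : R := \val t.

Lemma ivalP (t : I) : 0 <= ival t <= 1.
Proof. by case: t => t tP; exact: (set_mem tP). Qed.

Lemma ival_inj : injective ival.
Proof. exact: val_inj. Qed.

Lemma ival_clampE (r : R) : ival (clamp r) = Num.max 0 (Num.min 1 r).
Proof. by []. Qed.

Lemma clampK (t : I) : clamp (ival t) = t.
Proof.
apply: ival_inj; have /andP[t0 t1] := ivalP t.
by rewrite ival_clampE (min_idPr t1) (max_idPr t0).
Qed.

Lemma ival_clamp (r : R) : 0 <= r <= 1 -> ival (clamp r) = r.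
Proof. by move=> /andP[r0 r1]; rewrite ival_clampE (min_idPr r1) (max_idPr r0). Qed.

Lemma ival_continuous : continuous ival.
Proof. exact: initial_continuous. Qed.

Lemma minr_continuous (Z : topologicalType) (f g : Z -> R) :
  continuous f -> continuous g -> continuous (fun z => Num.min (f z) (g z)).
Proof.
move=> cf cg z; apply: (@continuous_comp _ _ _ (fun z => (f z, g z))
  (fun xy : R * R => Num.min xy.1 xy.2)); last exact: min_continuous.
exact: (cvg_pair (cf z) (cg z)).
Qed.

Lemma maxr_continuous (Z : topologicalType) (f g : Z -> R) :
  continuous f -> continuous g -> continuous (fun z => Num.max (f z) (g z)).
Proof.
move=> cf cg z; apply: (@continuous_comp _ _ _ (fun z => (f z, g z))
  (fun xy : R * R => Num.max xy.1 xy.2)); last exact: max_continuous.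
exact: (cvg_pair (cf z) (cg z)).
Qed.

Lemma clamp_continuous : continuous clamp.
Proof.
apply: continuous_comp_initial.
apply: maxr_continuous; first by move=> z; exact: cvg_cst.
by apply: minr_continuous => z; [exact: cvg_cst|exact: cvg_id].
Qed.

Lemma I01_zero_one_neq : clamp 0 != clamp 1.
Proof.
apply/eqP => /(congr1 ival); rewrite !ival_clamp ?lexx ?ler01 //.
by move/eqP; rewrite eq_sym oner_eq0.
Qed.

HB.instance Definition _ := isBiPointed.Build I I01_zero_one_neq.

Lemma ival0 : ival zero = 0.
Proof. by rewrite ival_clamp ?lexx ?ler01. Qed.

Lemma ival1 : ival one = 1.
Proof. by rewrite ival_clamp ?lexx ?ler01. Qed.

Lemma clamp0 (r : R) : r <= 0 -> clamp r = zero.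
Proof.
move=> r0; apply: ival_inj; rewrite ival0 ival_clampE.
by rewrite (min_idPr (le_trans r0 ler01)) (max_idPl r0).
Qed.

Lemma clamp1 (r : R) : 1 <= r -> clamp r = one.
Proof.
move=> r1; apply: ival_inj; rewrite ival1 ival_clampE.
by rewrite (min_idPl r1) (max_idPr ler01).
Qed.

End UnitInterval.

Section Glue.
Context {R : realType} {Z T : topologicalType}.

Lemma glue_continuous (c : Z -> R) (a : R) (u v : Z -> T) :
  continuous c -> continuous u -> continuous v ->
  (forall z, c z = a -> u z = v z) ->
  continuous (fun z => if c z <= a then u z else v z).
Proof.
move=> cc cu cv uv z U /=; have [cza|cza|cza] := ltgtP (c z) a => nU.
- have nc : \forall y \near z, c y < a by apply: (cvgr_lt _ (cc z)).
  by move: nc (cu z _ nU); apply: filterS2 => y /ltW /= ->.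
- have nc : \forall y \near z, a < c y by apply: (cvgr_gt _ (cc z)).
  by move: nc (cv z _ nU); apply: filterS2 => y /=; rewrite leNgt => ->.
- have nv : nbhs z (v @^-1` U) by apply: cv; rewrite -uv.
  by move: nv (cu z _ nU); apply: filterS2 => y /= ? ?; case: ifP.
Qed.

End Glue.

Section RealContinuity.
Context {R : realType} {Z : topologicalType}.
Implicit Types f g : Z -> R.

Lemma contD f g : continuous f -> continuous g ->
  continuous (fun z => f z + g z).
Proof. by move=> cf cg z; apply: cvgD; [exact: cf|exact: cg]. Qed.

Lemma contB f g : continuous f -> continuous g ->
  continuous (fun z => f z - g z).
Proof. by move=> cf cg z; apply: cvgB; [exact: cf|exact: cg]. Qed.

Lemma contM f g : continuous f -> continuous g ->
  continuous (fun z => f z * g z).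
Proof. by move=> cf cg z; apply: cvgM; [exact: cf|exact: cg]. Qed.

Lemma cont_cst (T : topologicalType) (a : T) : continuous (fun _ : Z => a).
Proof. by move=> z; exact: cvg_cst. Qed.

Lemma cont_clamp f : continuous f -> continuous (fun z => clamp (f z)).
Proof.
by move=> cf z; apply: continuous_comp; [exact: cf|exact: clamp_continuous].
Qed.

Lemma cont_ival (f : Z -> I01 R) : continuous f ->
  continuous (fun z => ival (f z)).
Proof.
by move=> cf z; apply: continuous_comp; [exact: cf|exact: ival_continuous].
Qed.

End RealContinuity.

Lemma cont_comp (X Y Z : topologicalType) (g : Y -> Z) (f : X -> Y) :
  continuous g -> continuous f -> continuous (fun x => g (f x)).
Proof. by move=> cg cf x; apply: continuous_comp; [exact: cf|exact: cg]. Qed.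

Lemma cont_pair (X Y Z : topologicalType) (f : X -> Y) (g : X -> Z) :
  continuous f -> continuous g -> continuous (fun x => (f x, g x)).
Proof. by move=> cf cg x; exact: (cvg_pair (cf x) (cg x)). Qed.

Lemma cont_fst (X Y : topologicalType) : continuous (fun z : X * Y => z.1).
Proof. by move=> z; exact: cvg_fst. Qed.

Lemma cont_snd (X Y : topologicalType) : continuous (fun z : X * Y => z.2).
Proof. by move=> z; exact: cvg_snd. Qed.

Section PathHomotopy.
Context {R : realType} {T : topologicalType}.
Local Notation I := (I01 R).
Implicit Types x y z : T.

Definition path_homotopic x y (f g : {path I from x to y}) : Prop :=
  exists H : I * I -> T,
    [/\ continuous H,
        forall s, H (s, zero) = f s, forall s, H (s, one) = g s,
        forall t, H (zero, t) = x & forall t, H (one, t) = y].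

Lemma reparam_homotopic x y (f g : {path I from x to y}) (h : I -> T)
    (u v : I -> R) :
  continuous h -> continuous u -> continuous v ->
  (forall s, f s = h (clamp (u s))) -> (forall s, g s = h (clamp (v s))) ->
  u zero = v zero -> u one = v one -> path_homotopic f g.
Proof.
move=> ch cu cv fE gE uv0 uv1.
exists (fun st : I * I =>
  h (clamp (u st.1 + ival st.2 * (v st.1 - u st.1)))); split => /=.
- apply: cont_comp => //; apply: cont_clamp.
  have cu' : continuous (fun st : I * I => u st.1).
    by apply: cont_comp => //; exact: cont_fst.
  have cv' : continuous (fun st : I * I => v st.1).
    by apply: cont_comp => //; exact: cont_fst.
  apply: contD => //; apply: contM; last exact: contB.
  by apply: cont_ival; exact: cont_snd.
- by move=> s; rewrite ival0 mul0r addr0 fE.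
- by move=> s; rewrite ival1 mul1r subrKC gE.
- by move=> t; rewrite uv0 subrr mulr0 addr0 -gE path_zero.
- by move=> t; rewrite uv1 subrr mulr0 addr0 -gE path_one.
Qed.

Lemma path_homotopic_refl x y (f : {path I from x to y}) : path_homotopic f f.
Proof.
apply: (@reparam_homotopic _ _ f f f ival ival) => //;
  by [exact: cts_fun|exact: ival_continuous|move=> s; rewrite clampK].
Qed.

Lemma path_homotopic_sym x y (f g : {path I from x to y}) :
  path_homotopic f g -> path_homotopic g f.
Proof.
move=> [H [cH Hf Hg Hx Hy]].
exists (fun st => H (st.1, clamp (1 - ival st.2))); split => //=.
- apply: cont_comp => //; apply: cont_pair; first exact: cont_fst.
  apply: cont_clamp; apply: contB; first exact: cont_cst.
  by apply: cont_ival; exact: cont_snd.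
- by move=> s; rewrite ival0 subr0.
- by move=> s; rewrite ival1 subrr.
Qed.

Lemma path_homotopic_trans x y (g f h : {path I from x to y}) :
  path_homotopic f g -> path_homotopic g h -> path_homotopic f h.
Proof.
move=> [H [cH Hf Hg Hx Hy]] [K [cK Kg Kh Kx Ky]].
have c2 : continuous (fun st : I * I => 2 * ival st.2).
  apply: contM; first exact: cont_cst.
  by apply: cont_ival; exact: cont_snd.
exists (fun st => if ival st.2 <= 2^-1 then H (st.1, clamp (2 * ival st.2))
                  else K (st.1, clamp (2 * ival st.2 - 1))); split.
- apply: (@glue_continuous R _ _ (fun st : I * I => ival st.2) 2^-1
     (fun st => H (st.1, clamp (2 * ival st.2)))
     (fun st => K (st.1, clamp (2 * ival st.2 - 1)))).
  + by apply: cont_ival; exact: cont_snd.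
  + apply: cont_comp => //; apply: cont_pair; first exact: cont_fst.
    exact: cont_clamp.
  + apply: cont_comp => //; apply: cont_pair; first exact: cont_fst.
    by apply: cont_clamp; apply: contB => //; exact: cont_cst.
  + by move=> st /= ->; rewrite divff ?pnatr_eq0 // subrr Hg Kg.
- by move=> s /=; rewrite ival0 invr_ge0 ler0n mulr0 Hf.
- move=> s /=; rewrite ival1 ifF ?mulr1; last by apply/negbTE; lra.
  by rewrite (_ : 2 - 1 = 1 :> R) ?Kh //; lra.
- by move=> t /=; case: ifP.
- by move=> t /=; case: ifP.
Qed.

Definition path_homotopicb x y : rel {path I from x to y} :=
  fun f g => `[< path_homotopic f g >].

Lemma path_homotopicb_equiv x y : equiv_class_of (@path_homotopicb x y).
Proof.
split=> [f|f g|g f h]; first exact/asboolP/path_homotopic_refl.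
  by apply/asboolP/asboolP; exact: path_homotopic_sym.
by move=> /asboolP fg /asboolP gh; exact/asboolP/(path_homotopic_trans fg).
Qed.

Canonical path_homotopicb_equivRel x y :=
  EquivRelPack (@path_homotopicb_equiv x y).

End PathHomotopy.

Definition path_class (R : realType) (T : topologicalType) (x y : T) :=
  {eq_quot (@path_homotopicb R T x y)}.

HB.instance Definition _ (R : realType) (T : topologicalType) (x y : T) :=
  EqQuotient.on (path_class R x y).
HB.instance Definition _ (R : realType) (T : topologicalType) (x y : T) :=
  Choice.on (path_class R x y).

Section PathClass.
Context {R : realType} {T : topologicalType}.
Local Notation I := (I01 R).
Local Notation class x y := (path_class R x y).
Implicit Types x y z : T.

Definition pcl x y (f : {path I from x to y}) : class x y :=
  \pi_(class x y) f.

Lemma pcl_repr x y (u : class x y) : pcl (repr u) = u.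
Proof. exact: reprK. Qed.

Lemma pclP x y (u : class x y) : exists f, u = pcl f.
Proof. by exists (repr u); rewrite pcl_repr. Qed.

Lemma path_classP x y (f g : {path I from x to y}) :
  pcl f = pcl g <-> path_homotopic f g.
Proof.
rewrite /pcl; split=> [/eqP|fg]; first by rewrite piE => /asboolP.
by apply/eqP; rewrite piE; apply/asboolP.
Qed.

Definition path_cat_fun (f g : I -> T) (s : I) : T :=
  if ival s <= 2^-1 then f (clamp (2 * ival s))
  else g (clamp (2 * ival s - 1)).

Lemma path_cat_cts x y z (f : {path I from x to y}) (g : {path I from y to z}) :
  continuous (path_cat_fun f g).
Proof.
have c2 : continuous (fun s : I => 2 * ival s).
  by apply: contM; [exact: cont_cst|exact: ival_continuous].
apply: (@glue_continuous R _ _ ival 2^-1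
  (fun s => f (clamp (2 * ival s))) (fun s => g (clamp (2 * ival s - 1)))).
- exact: ival_continuous.
- by apply: cont_comp; [exact: cts_fun|exact: cont_clamp].
- apply: cont_comp; first exact: cts_fun.
  by apply: cont_clamp; apply: contB => //; exact: cont_cst.
- by move=> s /= ->; rewrite divff ?pnatr_eq0 // subrr path_one path_zero.
Qed.

Lemma path_cat0 x y z (f : {path I from x to y}) (g : {path I from y to z}) :
  path_cat_fun f g zero = x.
Proof.
by rewrite /path_cat_fun ival0 invr_ge0 ler0n mulr0 path_zero.
Qed.

Lemma path_cat1 x y z (f : {path I from x to y}) (g : {path I from y to z}) :
  path_cat_fun f g one = z.
Proof.
rewrite /path_cat_fun ival1 ifF ?mulr1; last by apply/negbTE; lra.
by rewrite (_ : 2 - 1 = 1 :> R) ?path_one //; lra.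
Qed.

Definition path_cat x y z (f : {path I from x to y}) (g : {path I from y to z})
    : {path I from x to z} :=
  mk_path (@path_cat_cts x y z f g) (path_cat0 f g) (path_cat1 f g).

Definition path_rev_fun (f : I -> T) (s : I) : T := f (clamp (1 - ival s)).

Lemma path_rev_cts x y (f : {path I from x to y}) : continuous (path_rev_fun f).
Proof.
apply: cont_comp; first exact: cts_fun.
by apply: cont_clamp; apply: contB; [exact: cont_cst|exact: ival_continuous].
Qed.

Lemma path_rev0 x y (f : {path I from x to y}) : path_rev_fun f zero = y.
Proof. by rewrite /path_rev_fun ival0 subr0 path_one. Qed.

Lemma path_rev1 x y (f : {path I from x to y}) : path_rev_fun f one = x.
Proof. by rewrite /path_rev_fun ival1 subrr path_zero. Qed.

Definition path_rev x y (f : {path I from x to y}) : {path I from y to x} :=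
  mk_path (@path_rev_cts x y f) (path_rev0 f) (path_rev1 f).

Definition path_cst x : {path I from x to x} :=
  mk_path (@cont_cst I T x) erefl erefl.

Lemma path_cat_homotopic x y z (f f' : {path I from x to y})
    (g g' : {path I from y to z}) :
  path_homotopic f f' -> path_homotopic g g' ->
  path_homotopic (path_cat f g) (path_cat f' g').
Proof.
move=> [H [cH Hf Hf' Hx Hy]] [K [cK Kg Kg' Ky Kz]].
have c2 : continuous (fun st : I * I => 2 * ival st.1).
  apply: contM; first exact: cont_cst.
  by apply: cont_ival; exact: cont_fst.
exists (fun st => if ival st.1 <= 2^-1 then H (clamp (2 * ival st.1), st.2)
                  else K (clamp (2 * ival st.1 - 1), st.2)); split.
- apply: (@glue_continuous R _ _ (fun st : I * I => ival st.1) 2^-1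
     (fun st => H (clamp (2 * ival st.1), st.2))
     (fun st => K (clamp (2 * ival st.1 - 1), st.2))).
  + by apply: cont_ival; exact: cont_fst.
  + apply: cont_comp => //; apply: cont_pair; last exact: cont_snd.
    exact: cont_clamp.
  + apply: cont_comp => //; apply: cont_pair; last exact: cont_snd.
    by apply: cont_clamp; apply: contB => //; exact: cont_cst.
  + by move=> st /= ->; rewrite divff ?pnatr_eq0 // subrr Hy Ky.
- by move=> s /=; rewrite Hf Kg.
- by move=> s /=; rewrite Hf' Kg'.
- by move=> t /=; rewrite ival0 invr_ge0 ler0n mulr0 Hx.
- move=> t /=; rewrite ival1 ifF ?mulr1; last by apply/negbTE; lra.
  by rewrite (_ : 2 - 1 = 1 :> R) ?Kz //; lra.
Qed.

Lemma path_rev_homotopic x y (f f' : {path I from x to y}) :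
  path_homotopic f f' -> path_homotopic (path_rev f) (path_rev f').
Proof.
move=> [H [cH Hf Hf' Hx Hy]].
exists (fun st => H (clamp (1 - ival st.1), st.2)); split.
- apply: cont_comp => //; apply: cont_pair; last exact: cont_snd.
  apply: cont_clamp; apply: contB; first exact: cont_cst.
  by apply: cont_ival; exact: cont_fst.
- by move=> s /=; rewrite Hf.
- by move=> s /=; rewrite Hf'.
- by move=> t /=; rewrite ival0 subr0.
- by move=> t /=; rewrite ival1 subrr.
Qed.

Definition pc_id x : class x x := pcl (path_cst x).

Definition pc_comp x y z (u : class x y) (v : class y z) : class x z :=
  pcl (path_cat (repr u) (repr v)).

Definition pc_inv x y (u : class x y) : class y x := pcl (path_rev (repr u)).

Lemma path_homotopic_repr x y (f : {path I from x to y}) :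
  path_homotopic (repr (pcl f)) f.
Proof. by apply/path_classP; rewrite pcl_repr. Qed.

Lemma pc_compE x y z (f : {path I from x to y}) (g : {path I from y to z}) :
  pc_comp (pcl f) (pcl g) = pcl (path_cat f g).
Proof.
by apply/path_classP/path_cat_homotopic; exact: path_homotopic_repr.
Qed.

Lemma pc_invE x y (f : {path I from x to y}) :
  pc_inv (pcl f) = pcl (path_rev f).
Proof. by apply/path_classP/path_rev_homotopic/path_homotopic_repr. Qed.

Lemma pc_compA x y z w (a : class x y) (b : class y z) (c : class z w) :
  pc_comp a (pc_comp b c) = pc_comp (pc_comp a b) c.
Proof.
have [f ->] := pclP a; have [g ->] := pclP b; have [h ->] := pclP c.
rewrite !pc_compE; apply/path_classP.
pose v (s : I) : R :=
  Num.min (2 * ival s) (Num.min (ival s + 4^-1) (2^-1 * ival s + 2^-1)).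
have ci := @ival_continuous R.
apply: path_homotopic_sym.
apply: (@reparam_homotopic R T _ _ _ _ (path_cat f (path_cat g h)) v ival).
- exact: cts_fun.
- apply: minr_continuous; first by apply: contM => //; exact: cont_cst.
  apply: minr_continuous; first by apply: contD => //; exact: cont_cst.
  apply: contD; last exact: cont_cst.
  by apply: contM => //; exact: cont_cst.
- exact: ci.
- move=> s; have /andP[s0 s1] := ivalP s.
  rewrite /= /mk_path /path_cat_fun /= /mk_path /path_cat_fun /v.
  have [s4|s4] := leP (ival s) 4^-1.
    have mE : Num.min (2 * ival s)
       (Num.min (ival s + 4^-1) (2^-1 * ival s + 2^-1)) = 2 * ival s.
      by apply/min_idPl; rewrite le_min; apply/andP; split; lra.
    rewrite mE ival_clamp; last by apply/andP; split; lra.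
    rewrite ifT; last by lra.
    rewrite ifT; last by lra.
    by rewrite ifT //; lra.
  have [s2|s2] := leP (ival s) 2^-1.
    have mE : Num.min (2 * ival s)
       (Num.min (ival s + 4^-1) (2^-1 * ival s + 2^-1)) = ival s + 4^-1.
      rewrite [X in Num.min _ X](min_idPl _); last by lra.
      by apply/min_idPr; lra.
    rewrite mE !ival_clamp; [|apply/andP; split; lra..].
    rewrite ifF; last by apply/negbTE; rewrite -ltNge; lra.
    rewrite ifF; last by apply/negbTE; rewrite -ltNge; lra.
    rewrite ifT; last by lra.
    by congr (g (clamp _)); lra.
  have mE : Num.min (2 * ival s)
     (Num.min (ival s + 4^-1) (2^-1 * ival s + 2^-1)) = 2^-1 * ival s + 2^-1.
    rewrite (_ : Num.min (ival s + 4^-1) _ = 2^-1 * ival s + 2^-1).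
      by apply/min_idPr; lra.
    by apply/min_idPr; lra.
  rewrite mE !ival_clamp; [|apply/andP; split; lra..].
  rewrite ifF; last by apply/negbTE; rewrite -ltNge; lra.
  rewrite ifF; last by apply/negbTE; rewrite -ltNge; lra.
  by congr (h (clamp _)); lra.
- by move=> s; rewrite clampK.
- rewrite /v ival0 !mulr0 !add0r; apply/min_idPl; rewrite le_min.
  by apply/andP; split; lra.
- rewrite /v ival1 !mulr1 (_ : 2^-1 + 2^-1 = 1 :> R); last by lra.
  rewrite (_ : Num.min _ 1 = 1); first by apply/min_idPr; lra.
  by apply/min_idPr; lra.
Qed.

Lemma pc_id_comp x y (a : class x y) : pc_comp (pc_id x) a = a.
Proof.
have [f ->] := pclP a; rewrite pc_compE; apply/path_classP.
have ci := @ival_continuous R.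
apply: (@reparam_homotopic R T _ _ _ _ f
  (fun s => Num.max 0 (2 * ival s - 1)) ival) => //.
- exact: cts_fun.
- apply: maxr_continuous; first exact: cont_cst.
  apply: contB; last exact: cont_cst.
  by apply: contM => //; exact: cont_cst.
- move=> s; have /andP[s0 s1] := ivalP s.
  rewrite /= /mk_path /path_cat_fun /= /mk_path; case: leP => s2.
    by rewrite (max_idPl _) ?clamp0 ?path_zero //; lra.
  by rewrite (max_idPr _) //; lra.
- by move=> s; rewrite clampK.
- by rewrite ival0; apply/max_idPl; lra.
- rewrite ival1 mulr1 (_ : 2 - 1 = 1 :> R); last by lra.
  by apply/max_idPr; lra.
Qed.

Lemma pc_comp_id x y (a : class x y) : pc_comp a (pc_id y) = a.
Proof.
have [f ->] := pclP a; rewrite pc_compE; apply/path_classP.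
have ci := @ival_continuous R.
apply: (@reparam_homotopic R T _ _ _ _ f
  (fun s => Num.min (2 * ival s) 1) ival) => //.
- exact: cts_fun.
- apply: minr_continuous; last exact: cont_cst.
  by apply: contM => //; exact: cont_cst.
- move=> s; have /andP[s0 s1] := ivalP s.
  rewrite /= /mk_path /path_cat_fun /= /mk_path; case: leP => s2.
    by rewrite (min_idPl _) //; lra.
  by rewrite (min_idPr _) ?clamp1 ?path_one //; lra.
- by move=> s; rewrite clampK.
- by rewrite ival0 mulr0; apply/min_idPl; lra.
- by rewrite ival1 mulr1; apply/min_idPr; lra.
Qed.

Lemma pc_compV x y (a : class x y) : pc_comp a (pc_inv a) = pc_id x.
Proof.
have [f ->] := pclP a; rewrite pc_invE pc_compE; apply/path_classP.
have ci := @ival_continuous R.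
have c2 : continuous (fun s : I => 2 * ival s).
  by apply: contM => //; exact: cont_cst.
apply: (@reparam_homotopic R T _ _ _ _ f
  (fun s => Num.min (2 * ival s) (2 - 2 * ival s)) (fun=> 0)) => //.
- exact: cts_fun.
- by apply: minr_continuous => //; apply: contB => //; exact: cont_cst.
- exact: cont_cst.
- move=> s; have /andP[s0 s1] := ivalP s.
  rewrite /= /mk_path /path_cat_fun /= /mk_path; case: leP => s2.
    by rewrite (min_idPl _) //; lra.
  rewrite (min_idPr _); last by lra.
  rewrite /path_rev_fun ival_clamp; last by apply/andP; split; lra.
  by congr (f (clamp _)); lra.
- by move=> s; rewrite clamp0 // path_zero.
- by rewrite ival0 mulr0; apply/min_idPl; lra.
- by rewrite ival1 mulr1 subrr; apply/min_idPr; lra.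
Qed.

Lemma pc_invK x y (a : class x y) : pc_inv (pc_inv a) = a.
Proof.
have [f ->] := pclP a; rewrite !pc_invE; congr (pcl _); apply/path_eqP => s.
have /andP[s0 s1] := ivalP s; rewrite /= /mk_path /path_rev_fun /= /mk_path.
rewrite /path_rev_fun ival_clamp; last by apply/andP; split; lra.
by rewrite subKr clampK.
Qed.

Lemma pc_Vcomp x y (a : class x y) : pc_comp (pc_inv a) a = pc_id y.
Proof. by rewrite -{2}(pc_invK a) pc_compV. Qed.

End PathClass.

Section PathMap.
Context {R : realType} {T U : topologicalType}.
Local Notation I := (I01 R).
Variables (p : T -> U) (cp : continuous p).

Lemma path_map_cts x y (f : {path I from x to y}) : continuous (p \o f).
Proof. by apply: cont_comp => //; exact: cts_fun. Qed.

Lemma path_map0 x y x' (ex : p x = x') (f : {path I from x to y}) :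
  (p \o f) zero = x'.
Proof. by rewrite /= path_zero. Qed.

Lemma path_map1 x y y' (ey : p y = y') (f : {path I from x to y}) :
  (p \o f) one = y'.
Proof. by rewrite /= path_one. Qed.

Definition path_map x y x' y' (ex : p x = x') (ey : p y = y')
    (f : {path I from x to y}) : {path I from x' to y'} :=
  mk_path (@path_map_cts x y f) (path_map0 ex f) (path_map1 ey f).

(* The map induced by p on path classes; the proofs of [p x = x'] and
   [p y = y'] only fix the type of the result. *)
Definition pc_map x y x' y' (ex : p x = x') (ey : p y = y')
    (u : path_class R x y) : path_class R x' y' :=
  pcl (path_map ex ey (repr u)).

Lemma pc_mapE x y x' y' (ex : p x = x') (ey : p y = y')
    (f : {path I from x to y}) :
  pc_map ex ey (pcl f) = pcl (path_map ex ey f).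
Proof.
apply/path_classP; have [H [cH H0 H1 Hx Hy]] := path_homotopic_repr f.
exists (p \o H); split=> [|s|s|t|t] /=; first exact: cont_comp.
- by rewrite H0.
- by rewrite H1.
- by rewrite Hx.
- by rewrite Hy.
Qed.

End PathMap.

Record groupoid := Groupoid {
  gobj :> Type;
  ghom : gobj -> gobj -> choiceType;
  gid : forall a, ghom a a;
  gcomp : forall a b c, ghom a b -> ghom b c -> ghom a c;
  ginv : forall a b, ghom a b -> ghom b a;
  gcompA : forall a b c d (f : ghom a b) (g : ghom b c) (h : ghom c d),
    gcomp f (gcomp g h) = gcomp (gcomp f g) h;
  gid_comp : forall a b (f : ghom a b), gcomp (gid a) f = f;
  gcomp_id : forall a b (f : ghom a b), gcomp f (gid b) = f;
  gcompV : forall a b (f : ghom a b), gcomp f (ginv f) = gid a;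
  gVcomp : forall a b (f : ghom a b), gcomp (ginv f) f = gid b
}.

Arguments gid {_} a.

Record gfunctor (H K : groupoid) := GFunctor {
  fobj :> H -> K;
  fhom : forall a b, ghom a b -> ghom (fobj a) (fobj b);
  fhom_id : forall a, fhom (gid a) = gid (fobj a);
  fhom_comp : forall a b c (f : ghom a b) (g : ghom b c),
    fhom (gcomp f g) = gcomp (fhom f) (fhom g)
}.

Arguments fhom {H K} _ {a b} _.

Definition groupoid_iso (H K : groupoid) (F : gfunctor H K) : Prop :=
  bijective F /\ forall a b, bijective (@fhom H K F a b).

Definition fund_groupoid (R : realType) (T : topologicalType) (B : set T) :
    groupoid :=
  @Groupoid (set_type B) (fun a b => path_class R (\val a) (\val b))
    (fun a => pc_id (\val a)) (fun a b c => @pc_comp R T _ _ _)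
    (fun a b => @pc_inv R T _ _)
    (fun a b c d => @pc_compA R T _ _ _ _) (fun a b => @pc_id_comp R T _ _)
    (fun a b => @pc_comp_id R T _ _) (fun a b => @pc_compV R T _ _)
    (fun a b => @pc_Vcomp R T _ _).

Definition pi1 (R : realType) (T : topologicalType) (x : T) : Type :=
  path_class R x x.

HB.instance Definition _ (R : realType) (T : topologicalType) (x : T) :=
  Choice.on (pi1 R x).
HB.instance Definition _ (R : realType) (T : topologicalType) (x : T) :=
  isGroup.Build (pi1 R x)
    (@pc_compA R T x x x x) (@pc_id_comp R T x x) (@pc_comp_id R T x x)
    (@pc_Vcomp R T x x) (@pc_compV R T x x).

Local Open Scope group_scope.

Record normal_subgroup (F : groupType) := NormalSubgroup {
  nset :> F -> Prop;
  nset1 : nset 1;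
  nsetM : forall u v, nset u -> nset v -> nset (u * v);
  nsetV : forall u, nset u -> nset u^-1;
  nsetJ : forall u v, nset u -> nset (u ^ v)
}.

Section QuotientGroup.
Variables (F : groupType) (N : normal_subgroup F).

Definition coset_rel : rel F := fun u v => `[< N (u^-1 * v) >].

Lemma coset_rel_equiv : equiv_class_of coset_rel.
Proof.
split=> [u|u v|v u w]; rewrite /coset_rel.
- by apply/asboolP; rewrite mulVg; exact: nset1.
- by apply/asboolP/asboolP => /nsetV; rewrite invgM invgK.
- move=> /asboolP uv /asboolP vw; apply/asboolP.
  by have := nsetM uv vw; rewrite mulgA mulgK.
Qed.

Canonical coset_rel_equivRel := EquivRelPack coset_rel_equiv.

Definition quot_group : Type := {eq_quot coset_rel}.

HB.instance Definition _ := EqQuotient.on quot_group.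
HB.instance Definition _ := Choice.on quot_group.

Definition quot_mor (u : F) : quot_group := \pi_quot_group u.

Lemma quot_morP u v : quot_mor u = quot_mor v <-> N (u^-1 * v).
Proof.
rewrite /quot_mor; split=> [/eqP|uv]; first by rewrite piE => /asboolP.
by apply/eqP; rewrite piE; apply/asboolP.
Qed.

Lemma quot_morK (g : quot_group) : quot_mor (repr g) = g.
Proof. exact: reprK. Qed.

Definition quot_one : quot_group := quot_mor 1.
Definition quot_mul (g h : quot_group) := quot_mor (repr g * repr h).
Definition quot_inv (g : quot_group) := quot_mor (repr g)^-1.

Lemma quot_mulE u v : quot_mul (quot_mor u) (quot_mor v) = quot_mor (u * v).
Proof.
apply/quot_morP.
have /quot_morP/(nsetJ v) uN := quot_morK (quot_mor u).
have /quot_morP vN := quot_morK (quot_mor v).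
have := nsetM vN uN; rewrite conjgE invgM !mulgA.
by rewrite mulgK.
Qed.

Lemma quot_invE u : quot_inv (quot_mor u) = quot_mor u^-1.
Proof.
apply/quot_morP; have /quot_morP := quot_morK (quot_mor u).
move/(nsetJ u^-1)/nsetV; rewrite conjgE invgK mulgK invgM.
by rewrite invgK.
Qed.

Lemma quot_morS (g : quot_group) : exists u, g = quot_mor u.
Proof. by exists (repr g); rewrite quot_morK. Qed.

Lemma quot_mulA : associative quot_mul.
Proof.
move=> g h k; have [u ->] := quot_morS g; have [v ->] := quot_morS h.
by have [w ->] := quot_morS k; rewrite !quot_mulE mulgA.
Qed.

Lemma quot_mul1g : left_id quot_one quot_mul.
Proof. by move=> g; have [u ->] := quot_morS g; rewrite quot_mulE mul1g. Qed.

Lemma quot_mulg1 : right_id quot_one quot_mul.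
Proof. by move=> g; have [u ->] := quot_morS g; rewrite quot_mulE mulg1. Qed.

Lemma quot_mulVg : left_inverse quot_one quot_inv quot_mul.
Proof.
by move=> g; have [u ->] := quot_morS g; rewrite quot_invE quot_mulE mulVg.
Qed.

Lemma quot_mulgV : right_inverse quot_one quot_inv quot_mul.
Proof.
by move=> g; have [u ->] := quot_morS g; rewrite quot_invE quot_mulE mulgV.
Qed.

HB.instance Definition _ := isGroup.Build quot_group
  quot_mulA quot_mul1g quot_mulg1 quot_mulVg quot_mulgV.

Lemma quot_morM : {morph quot_mor : u v / u * v}.
Proof. by move=> u v; rewrite -[RHS]/(quot_mul _ _) quot_mulE. Qed.

HB.instance Definition _ := isMultiplicative.Build F quot_group quot_mor
  quot_morM.

End QuotientGroup.

Section CoveringGroupoid.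
Variables (F G : groupType) (phi : {multiplicative F -> G}).

Lemma mor1 : phi 1 = 1.
Proof. by apply: (@mulgI _ (phi 1)); rewrite -gmulfM !mulg1. Qed.

(* The pullback along phi of the universal covering groupoid of G. Its objects
   are the elements of G; the pair (u, g), with source (phi u) g and target g,
   is the element u of [Fhat_hom a g] for the unique possible source a. *)
Definition Fhat_hom (a b : G) : choiceType := {u : F | phi u * b == a}.

Lemma Fhat_id_subproof (a : G) : phi 1 * a == a.
Proof. by rewrite mor1 mul1g. Qed.

Definition Fhat_id a : Fhat_hom a a := exist _ 1 (Fhat_id_subproof a).

Lemma Fhat_comp_subproof a b c (u : Fhat_hom a b) (v : Fhat_hom b c) :
  phi (\val u * \val v) * c == a.
Proof.
case: u v => [u /= /eqP ua] [v /= /eqP vb].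
by rewrite gmulfM -mulgA vb ua.
Qed.

Definition Fhat_comp a b c (u : Fhat_hom a b) (v : Fhat_hom b c) :
    Fhat_hom a c :=
  exist _ (\val u * \val v) (Fhat_comp_subproof u v).

Lemma Fhat_inv_subproof a b (u : Fhat_hom a b) : phi (\val u)^-1 * a == b.
Proof.
case: u => [u /= /eqP <-]; rewrite mulgA -gmulfM mulVg mor1 mul1g //.
Qed.

Definition Fhat_inv a b (u : Fhat_hom a b) : Fhat_hom b a :=
  exist _ (\val u)^-1 (Fhat_inv_subproof u).

Lemma Fhat_compA a b c d (u : Fhat_hom a b) (v : Fhat_hom b c)
  (w : Fhat_hom c d) : Fhat_comp u (Fhat_comp v w) = Fhat_comp (Fhat_comp u v) w.
Proof. by apply: val_inj; rewrite /= mulgA. Qed.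

Lemma Fhat_id_comp a b (u : Fhat_hom a b) : Fhat_comp (Fhat_id a) u = u.
Proof. by apply: val_inj; rewrite /= mul1g. Qed.

Lemma Fhat_comp_id a b (u : Fhat_hom a b) : Fhat_comp u (Fhat_id b) = u.
Proof. by apply: val_inj; rewrite /= mulg1. Qed.

Lemma Fhat_compV a b (u : Fhat_hom a b) :
  Fhat_comp u (Fhat_inv u) = Fhat_id a.
Proof. by apply: val_inj; rewrite /= mulgV. Qed.

Lemma Fhat_Vcomp a b (u : Fhat_hom a b) :
  Fhat_comp (Fhat_inv u) u = Fhat_id b.
Proof. by apply: val_inj; rewrite /= mulVg. Qed.

Definition Fhat : groupoid :=
  Groupoid Fhat_compA Fhat_id_comp Fhat_comp_id Fhat_compV Fhat_Vcomp.

Definition Fhat_proj (a b : Fhat) (u : ghom a b) : F := \val (u : Fhat_hom a b).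

Lemma Fhat_shift_subproof (k a b : G) (u : Fhat_hom a b) :
  phi (\val u) * (b * k) == a * k.
Proof. by case: u => [u /= /eqP <-]; rewrite mulgA. Qed.

Definition Fhat_shift_hom (k a b : G) (u : Fhat_hom a b) :
    Fhat_hom (a * k) (b * k) :=
  exist _ (\val u) (Fhat_shift_subproof k u).

Lemma Fhat_shift_id (k : G) (a : Fhat) :
  Fhat_shift_hom k (gid a) = Fhat_id (a * k).
Proof. exact: val_inj. Qed.

Lemma Fhat_shift_comp (k : G) (a b c : Fhat) (u : ghom a b) (v : ghom b c) :
  Fhat_shift_hom k (gcomp u v)
  = Fhat_comp (Fhat_shift_hom k u) (Fhat_shift_hom k v).
Proof. exact: val_inj. Qed.

Definition Fhat_shift (k : G) : gfunctor Fhat Fhat :=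
  @GFunctor Fhat Fhat (fun a : G => a * k) (@Fhat_shift_hom k)
    (Fhat_shift_id k) (Fhat_shift_comp k).

End CoveringGroupoid.

Section Pullback.
Variables (F G : groupType) (phi : {multiplicative F -> G}).

(* The universal covering groupoid of G: the pair (g, h), with source g h and
   target h, is the element g of [ghom (g * h) h]. *)
Definition universal_covering_groupoid : groupoid := Fhat (@idfun G).

Lemma Fhat_over_subproof (a b : G) (u : Fhat_hom phi a b) :
  idfun (phi (\val u)) * b == a.
Proof. exact: valP u. Qed.

Definition Fhat_over (a b : G) (u : Fhat_hom phi a b) :
    @ghom universal_covering_groupoid a b :=
  exist _ (phi (\val u)) (Fhat_over_subproof u).

Lemma Fhat_pullback (a b : G) (u : F)
    (w : @ghom universal_covering_groupoid a b) :
  phi u = Fhat_proj w ->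
  exists! v : @ghom (Fhat phi) a b, Fhat_proj v = u /\ Fhat_over v = w.
Proof.
move=> uw; have uP : phi u * b == a by rewrite uw; exact: valP w.
exists (exist _ u uP : Fhat_hom phi a b); split.
  by split=> //; exact: val_inj.
by move=> v [vu _]; apply: val_inj.
Qed.

End Pullback.

Local Close Scope group_scope.

Section FreeAbelian.
Variables (K : choiceType) (V : zmodType) (f : K -> V).

(* [fglift] needs a Z-module as its target. *)
Definition free_lift (c : {freeg K / int}) : V :=
  fglift (f : K -> zmodule V) c.

Lemma free_lift_is_zmod_morphism : zmod_morphism free_lift.
Proof. exact: (lift_is_additive (f : K -> zmodule V)). Qed.

HB.instance Definition _ := GRing.isZmodMorphism.Build {freeg K / int} V
  free_lift free_lift_is_zmod_morphism.

Lemma free_liftU k : free_lift << k >> = f k.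
Proof. by rewrite /free_lift liftU scale1r. Qed.

End FreeAbelian.

Section ZmodQuotientLift.
Variables (V W : zmodType) (J : zmodClosed V) (f : {additive V -> W}).
Hypothesis fJ : forall v, v \in J -> f v = 0.

Definition zquot_lift (q : Quotient.quot J) : W := let _ := fJ in f (repr q).

Lemma zquot_liftE v : zquot_lift (\pi_(Quotient.quot J) v) = f v.
Proof.
apply/eqP; rewrite -subr_eq0 -raddfB; apply/eqP/fJ.
by rewrite Quotient.idealrBE reprK.
Qed.

Lemma zquot_lift_is_zmod_morphism : zmod_morphism zquot_lift.
Proof.
elim/quotW=> v; elim/quotW=> w.
by rewrite -(raddfB (\pi_(Quotient.quot J))) !zquot_liftE raddfB.
Qed.

HB.instance Definition _ := GRing.isZmodMorphism.Build (Quotient.quot J) W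
  zquot_lift zquot_lift_is_zmod_morphism.

End ZmodQuotientLift.

Section Homology.
Variables (A B C : zmodType) (f : {additive A -> B}) (g : {additive B -> C}).

Definition ker_pred : {pred B} := fun b => g b == 0.

Lemma ker_pred_closed : zmod_closed ker_pred.
Proof.
split=> [|b b']; rewrite !unfold_in ?raddf0 //.
by move=> /eqP gb /eqP gb'; rewrite raddfB gb gb' subrr.
Qed.

HB.instance Definition _ := GRing.isZmodClosed.Build B ker_pred ker_pred_closed.

Record cycles := Cycle { cycle_val :> B; _ : cycle_val \in ker_pred }.

HB.instance Definition _ := [isSub for cycle_val].
HB.instance Definition _ := [Choice of cycles by <:].
HB.instance Definition _ := [SubChoice_isSubZmodule of cycles by <:].

Definition boundaries : {pred cycles} :=
  fun z => `[< exists a, f a = cycle_val z >].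

Lemma boundaries_closed : zmod_closed boundaries.
Proof.
split=> [|z z']; rewrite !unfold_in; first by apply/asboolP; exists 0; rewrite raddf0.
move=> /asboolP[a fa] /asboolP[a' fa']; apply/asboolP; exists (a - a').
by rewrite raddfB fa fa'.
Qed.

HB.instance Definition _ := GRing.isZmodClosed.Build cycles boundaries
  boundaries_closed.

Definition homology : zmodType := Quotient.quot boundaries.

End Homology.

Section Singular.
Variable (R : realType).

Definition std_simplex (n : nat) : Type :=
  set_type [set v : 'rV[R]_n.+1 |
    (forall i, 0 <= v ord0 i) /\ \sum_i v ord0 i = 1].

HB.instance Definition _ (n : nat) := Topological.on (std_simplex n).

Definition bary n (v : std_simplex n) : 'rV[R]_n.+1 := \val v.

Lemma baryP n (v : std_simplex n) :
  (forall i, 0 <= bary v ord0 i) /\ \sum_i bary v ord0 i = 1.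
Proof. by case: v => v vP; exact: (set_mem vP). Qed.

Lemma bary_inj n : injective (@bary n).
Proof. exact: val_inj. Qed.

Lemma bary_continuous n (i : 'I_n.+1) :
  continuous (fun v : std_simplex n => bary v ord0 i).
Proof.
apply: (@cont_comp _ _ _ (fun v : 'rV[R]_n.+1 => v ord0 i) (@bary n)).
  exact: coord_continuous.
exact: initial_continuous.
Qed.

(* The i-th face of the standard simplex: put a zero in position i. *)
Definition face_vec n (i : 'I_n.+2) (v : 'rV[R]_n.+1) : 'rV[R]_n.+2 :=
  \row_j (if unlift i j is Some k then v ord0 k else 0).

Lemma face_subproof n (i : 'I_n.+2) (v : std_simplex n) :
  face_vec i (bary v) \in [set v : 'rV[R]_n.+2 |
    (forall i, 0 <= v ord0 i) /\ \sum_i v ord0 i = 1].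
Proof.
have [v0 v1] := baryP v; apply/mem_set; split=> [j|].
  by rewrite mxE; case: unliftP.
rewrite (bigD1_ord i) //= mxE unlift_none add0r -[RHS]v1.
by apply: eq_bigr => j _; rewrite mxE liftK.
Qed.

Definition face n (i : 'I_n.+2) (v : std_simplex n) : std_simplex n.+1 :=
  exist _ (face_vec i (bary v)) (face_subproof i v).

Lemma face_continuous n (i : 'I_n.+2) : continuous (@face n i).
Proof.
have cj (j : 'I_n.+2) :
    continuous (fun w : std_simplex n => face_vec i (bary w) ord0 j).
  case: (unliftP i j) => [k ->|->].
    rewrite (_ : (fun w => _) = (fun w : std_simplex n => bary w ord0 k)).
      exact: bary_continuous.
    by apply/funext => w; rewrite mxE liftK.
  rewrite (_ : (fun w => _) = (fun _ : std_simplex n => 0)).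
    exact: cont_cst.
  by apply/funext => w; rewrite mxE unlift_none.
apply: continuous_comp_initial => v U [P nP PU].
have FF : Filter (nbhs v) by apply: nbhs_filter.
have nQ : \forall w \near v, forall j, P ord0 j (face_vec i (bary w) ord0 j).
  exact: (filter_forall FF (fun j => cj j v _ (nP ord0 j))).
move: nQ; apply: filterS => w Pw; apply: PU => a j.
by rewrite ord1; exact: Pw.
Qed.

HB.instance Definition _ n (i : 'I_n.+2) :=
  @isContinuous.Build _ _ (@face n i) (@face_continuous n i).

Variable (Y : topologicalType).

Definition simplex (n : nat) : choiceType := continuousType (std_simplex n) Y.

Definition chain (n : nat) : zmodType := {freeg (simplex n) / int}.

Definition simplex_face n (i : 'I_n.+2) (s : simplex n.+1) : simplex n :=
  s \o face i.

Definition simplex_bd n (s : simplex n.+1) : chain n :=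
  \sum_(i < n.+2) (-1) ^+ i *: << simplex_face i s >>.

Definition chain_bdS n : chain n.+1 -> chain n := free_lift (@simplex_bd n).
HB.instance Definition _ n := GRing.Additive.on (@chain_bdS n).

Lemma chain_bdSU n (s : simplex n.+1) : chain_bdS << s >> = simplex_bd s.
Proof. exact: free_liftU. Qed.

(* Chains of the subspace B, as a subgroup of the chains of Y. *)
Definition subchain (B : set Y) n : {pred chain n} :=
  fun c => `[< forall s : simplex n, coeff s c != 0 -> forall v, B (s v) >].

Lemma subchain_closed (B : set Y) n : zmod_closed (@subchain B n).
Proof.
split=> [|c c']; rewrite !unfold_in.
  by apply/asboolP => s; rewrite coeff0 eqxx.
move=> /asboolP cB /asboolP cB'; apply/asboolP => s; rewrite coeffB.
have [->|/cB//] := eqVneq (coeff s c) 0.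
have [->|/cB'//] := eqVneq (coeff s c') 0.
by rewrite subrr eqxx.
Qed.

HB.instance Definition _ (B : set Y) n :=
  GRing.isZmodClosed.Build (chain n) (@subchain B n) (@subchain_closed B n).

Lemma subchainU (B : set Y) n (s : simplex n) :
  (forall v, B (s v)) -> << s >> \in subchain B (n := n).
Proof.
move=> sB; rewrite unfold_in; apply/asboolP => s'.
by rewrite coeffU mul1r; have [<-|] := eqVneq s s'.
Qed.

Lemma chain_bdS_sub (B : set Y) n (c : chain n.+1) :
  c \in subchain B (n := n.+1) -> chain_bdS c \in subchain B (n := n).
Proof.
move=> /asboolP cB; rewrite -[c]freeg_sumE raddf_sum big_seq.
apply: rpred_sum => s; rewrite mem_dom => /cB sB.
have -> : << coeff s c *g s >> = << s >> *~ coeff s c.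
  by apply/eqP/freeg_eqP => t; rewrite raddfMz /= !coeffU mul1r -mulrzr intz mulrC.
rewrite raddfMz; apply: rpredMz; rewrite /= chain_bdSU.
apply: rpred_sum => i _; rewrite -signr_odd scaler_sign.
have iB : << simplex_face i s >> \in subchain B (n := n).
  by apply: subchainU => v; exact: sB.
by case: odd; rewrite ?rpredN.
Qed.

Definition chain_bd n : chain n -> chain n.-1 :=
  if n is m.+1 then @chain_bdS m else fun=> 0.

Lemma chain_bd_is_zmod_morphism n : zmod_morphism (@chain_bd n).
Proof. by case: n => [c c'|n]; [rewrite subrr|exact: raddfB]. Qed.

HB.instance Definition _ n := GRing.isZmodMorphism.Build (chain n) (chain n.-1)
  (@chain_bd n) (@chain_bd_is_zmod_morphism n).

Variable B : set Y.

Definition rel_chain (n : nat) : zmodType := Quotient.quot (@subchain B n).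

Definition rel_pi n : chain n -> rel_chain n := \pi_(Quotient.quot (@subchain B n)).
HB.instance Definition _ n := GRing.Additive.on (@rel_pi n).

Lemma rel_pi_eq0 n (c : chain n) : rel_pi c = 0 <-> c \in subchain B (n := n).
Proof.
rewrite /rel_pi -[c in c \in _]subr0 Quotient.idealrBE.
by rewrite -[0 in RHS](raddf0 (@rel_pi n)); split=> [->|/eqP].
Qed.

Lemma rel_bd_subproof n (c : chain n) :
  c \in subchain B (n := n) -> (@rel_pi n.-1 \o @chain_bd n) c = 0.
Proof.
move=> cB; apply/rel_pi_eq0; case: n c cB => [|n] c cB; first exact: rpred0.
exact: chain_bdS_sub.
Qed.

Definition rel_bd n : rel_chain n -> rel_chain n.-1 :=
  zquot_lift (@rel_bd_subproof n).
HB.instance Definition _ n := GRing.Additive.on (@rel_bd n).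

Lemma rel_bdE n (c : chain n) : rel_bd (rel_pi c) = rel_pi (chain_bd c).
Proof. exact: (zquot_liftE (@rel_bd_subproof n)). Qed.

Definition sing_homology (n : nat) : zmodType :=
  homology (@rel_bd n.+1) (@rel_bd n).

End Singular.

Record arrow (H : groupoid) := Arrow {
  asrc : H;
  atgt : H;
  ahom : ghom asrc atgt
}.

HB.instance Definition _ (H : groupoid) := gen_eqMixin (arrow H).
HB.instance Definition _ (H : groupoid) := gen_choiceMixin (arrow H).

Section Totab.
Variable (H : groupoid).

(* A morphism from H to the abelian group V, seen as a groupoid with one
   object. *)
Definition to_abelian (V : zmodType) (f : arrow H -> V) : Prop :=
  forall (a b c : H) (u : ghom a b) (v : ghom b c),
    f (Arrow (gcomp u v)) = f (Arrow u) + f (Arrow v).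

Definition free_arrows : zmodType := {freeg (arrow H) / int}.

(* The subgroup generated by the elements [gh] - ([g] + [h]). *)
Definition totab_rel : {pred free_arrows} :=
  fun c => `[< forall J : {pred free_arrows}, zmod_closed J ->
    (forall (a b c : H) (u : ghom a b) (v : ghom b c),
      << Arrow (gcomp u v) >> - (<< Arrow u >> + << Arrow v >>) \in J) ->
    c \in J >].

Lemma totab_rel_closed : zmod_closed totab_rel.
Proof.
split=> [|c c']; rewrite !unfold_in; first by apply/asboolP => J [].
move=> /asboolP cJ /asboolP cJ'; apply/asboolP => J Jz Jr.
by apply: Jz.2; [exact: cJ|exact: cJ'].
Qed.

HB.instance Definition _ :=
  GRing.isZmodClosed.Build free_arrows totab_rel totab_rel_closed.

Definition totab : zmodType := Quotient.quot totab_rel.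

Definition totab_in (x : arrow H) : totab := \pi_(Quotient.quot totab_rel) << x >>.

Lemma totab_in_comp : to_abelian totab_in.
Proof.
move=> a b c u v; apply/eqP; rewrite /totab_in -raddfD -subr_eq0 -raddfB.
rewrite -(raddf0 \pi_(Quotient.quot totab_rel)) -Quotient.idealrBE subr0.
by rewrite unfold_in; apply/asboolP => J _; exact.
Qed.

Section Lift.
Variables (V : zmodType) (f : arrow H -> V) (fM : to_abelian f).

Lemma totab_lift_subproof c : c \in totab_rel -> free_lift f c = 0.
Proof.
rewrite unfold_in => /asboolP /(_ (fun c => free_lift f c == 0)) fc.
apply/eqP; apply: fc => [|a b d u v].
  split=> [|x y]; rewrite !unfold_in ?raddf0 // => /eqP fx /eqP fy.
  by rewrite raddfB /= fx fy subrr.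
by rewrite unfold_in raddfB raddfD /= !free_liftU fM subrr.
Qed.

Definition totab_lift : totab -> V := zquot_lift totab_lift_subproof.
HB.instance Definition _ := GRing.Additive.on totab_lift.

Lemma totab_liftE x : totab_lift (totab_in x) = f x.
Proof. by rewrite /totab_lift zquot_liftE /= free_liftU. Qed.

End Lift.

Lemma totab_ext (V : zmodType) (f g : totab -> V) :
  zmod_morphism f -> zmod_morphism g ->
  (forall x, f (totab_in x) = g (totab_in x)) -> f =1 g.
Proof.
move=> fB gB fg; elim/quotW=> c.
pose f' : {additive totab -> V} := HB.pack f (GRing.isZmodMorphism.Build _ _ f fB).
pose g' : {additive totab -> V} := HB.pack g (GRing.isZmodMorphism.Build _ _ g gB).
rewrite -[f]/(f' : totab -> V) -[g]/(g' : totab -> V).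
rewrite -[c]freeg_sumE !raddf_sum; apply: eq_bigr => x _.
have -> : << coeff x c *g x >> = << x >> *~ coeff x c.
  by apply/eqP/freeg_eqP => t; rewrite raddfMz /= !coeffU mul1r -mulrzr intz mulrC.
by rewrite !raddfMz; congr (_ *~ _); exact: fg.
Qed.

Lemma totab_universal (V : zmodType) (f : arrow H -> V) : to_abelian f ->
  exists! g : totab -> V, zmod_morphism g /\ forall x, g (totab_in x) = f x.
Proof.
move=> fM; exists (totab_lift fM); split.
  by split; [exact: raddfB|exact: totab_liftE].
move=> g [gB gE]; apply/funext; apply: totab_ext => //; first exact: raddfB.
by move=> x; rewrite totab_liftE gE.
Qed.

End Totab.

Definition map_arrow (H K : groupoid) (F : gfunctor H K) (x : arrow H) :
  arrow K := Arrow (fhom F (ahom x)).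

Lemma totab_map_subproof (H K : groupoid) (F : gfunctor H K) :
  to_abelian (fun x => totab_in (map_arrow F x)).
Proof. by move=> a b c u v; rewrite /map_arrow /= fhom_comp totab_in_comp. Qed.

Definition totab_map (H K : groupoid) (F : gfunctor H K) : totab H -> totab K :=
  totab_lift (@totab_map_subproof H K F).
HB.instance Definition _ (H K : groupoid) (F : gfunctor H K) :=
  GRing.Additive.on (totab_map F).

Record rmodule (G : groupType) := RModule {
  rcar :> zmodType;
  ract : rcar -> G -> rcar;
  ractD : forall m n g, ract (m + n) g = ract m g + ract n g;
  ract1 : forall m, ract m 1%g = m;
  ractM : forall m g h, ract m (g * h)%g = ract (ract m g) h
}.

Arguments ract {G r} _ _.

Definition rmodule_morphism (G : groupType) (M M' : rmodule G) (f : M -> M') :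
    Prop :=
  zmod_morphism f /\ forall m g, f (ract m g) = ract (f m) g.

Definition derivation (F G : groupType) (phi : F -> G) (M : rmodule G)
    (d : F -> M) : Prop :=
  forall u v, d (u * v)%g = ract (d u) (phi v) + d v.

Definition universal_derivation (F G : groupType) (phi : F -> G)
    (D : rmodule G) (d : F -> D) : Prop :=
  derivation phi d /\
  forall (M : rmodule G) (e : F -> M), derivation phi e ->
    exists! f : D -> M, rmodule_morphism f /\ forall u, f (d u) = e u.

Section FhatModule.
Variables (F G : groupType) (phi : {multiplicative F -> G}).

Definition Fhat_act (m : totab (Fhat phi)) (k : G) : totab (Fhat phi) :=
  totab_map (Fhat_shift phi k) m.

Lemma Fhat_actD m n k : Fhat_act (m + n) k = Fhat_act m k + Fhat_act n k.
Proof. exact: raddfD. Qed.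

Lemma Fhat_arrow_eq (a b a' b' : G) (u : Fhat_hom phi a b)
    (v : Fhat_hom phi a' b') :
  b = b' -> \val u = \val v ->
  @Arrow (Fhat phi) a b u = @Arrow (Fhat phi) a' b' v.
Proof.
move=> eb; case: _ / eb v => v.
case: u => u /= uP; case: v => v /= vP uv; case: _ / uv vP => vP.
move: (eqP uP) (eqP vP) => ea ea'.
case: _ / ea uP => uP; case: _ / ea' vP => vP.
by rewrite (bool_irrelevance uP vP).
Qed.

Lemma Fhat_act1 m : Fhat_act m 1%g = m.
Proof.
apply: (@totab_ext _ _ (totab_map (Fhat_shift phi 1%g)) idfun) => //.
  exact: raddfB.
move=> [a b u]; rewrite /= /totab_map totab_liftE /=; congr totab_in.
by apply: Fhat_arrow_eq => //=; rewrite mulg1.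
Qed.

Lemma Fhat_actM m g h : Fhat_act m (g * h)%g = Fhat_act (Fhat_act m g) h.
Proof.
apply: (@totab_ext _ _ (totab_map (Fhat_shift phi (g * h)%g))
  (totab_map (Fhat_shift phi h) \o totab_map (Fhat_shift phi g))).
- exact: raddfB.
- exact: raddfB.
move=> [a b u]; rewrite /= /totab_map !totab_liftE /=; congr totab_in.
by apply: Fhat_arrow_eq => //=; rewrite mulgA.
Qed.

(* The right action of G induced by (u, g)^k = (u, g k). *)
Definition Fhat_module : rmodule G :=
  @RModule G (totab (Fhat phi)) Fhat_act Fhat_actD Fhat_act1 Fhat_actM.

End FhatModule.

Record zmod_iso (V W : zmodType) := ZmodIso {
  iso_fun :> V -> W;
  iso_inv : W -> V;
  iso_funB : zmod_morphism iso_fun;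
  iso_funK : cancel iso_fun iso_inv;
  iso_invK : cancel iso_inv iso_fun
}.

Section Transport.
Variables (G : groupType) (M : rmodule G) (V : zmodType) (z : zmod_iso M V).

HB.instance Definition _ := GRing.isZmodMorphism.Build M V z (iso_funB z).

Definition transport_act (v : V) (g : G) : V := z (ract (iso_inv z v) g).

Lemma transport_actD v w g :
  transport_act (v + w) g = transport_act v g + transport_act w g.
Proof.
rewrite /transport_act -raddfD -ractD; congr (z (ract _ g)).
by apply: (can_inj (iso_funK z)); rewrite raddfD /= !iso_invK.
Qed.

Lemma transport_act1 v : transport_act v 1%g = v.
Proof. by rewrite /transport_act ract1 iso_invK. Qed.

Lemma transport_actM v g h :
  transport_act v (g * h)%g = transport_act (transport_act v g) h.
Proof. by rewrite /transport_act iso_funK ractM. Qed.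

Definition transport_module : rmodule G :=
  @RModule G V transport_act transport_actD transport_act1 transport_actM.

End Transport.

Section PathCycle.
Context {R : realType} {Y : topologicalType} (B : set Y).
Local Notation I := (I01 R).

Lemma path_simplex_cts (f : I -> Y) : continuous f ->
  continuous (fun v : std_simplex R 1 => f (clamp (bary v ord0 ord_max))).
Proof.
by move=> cf; apply: cont_comp => //; apply: cont_clamp; exact: bary_continuous.
Qed.

(* A path regarded as a singular 1-simplex: its value at (1 - t, t) is the
   value of the path at t. *)
Definition path_simplex x y (f : {path I from x to y}) : simplex R Y 1 :=
  mkcts (path_simplex_cts (@cts_fun _ _ f)).

Lemma path_simplex_cycle (x y : Y) (f : {path I from x to y}) : B x -> B y ->
  rel_pi B (<< path_simplex f >> : chain R Y 1)
    \in ker_pred (@rel_bd R Y B 1).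
Proof.
move=> Bx By; rewrite unfold_in; apply/eqP; rewrite [LHS]rel_bdE.
apply/rel_pi_eq0; rewrite [chain_bd _]chain_bdSU.
apply: rpred_sum => i _; rewrite -signr_odd scaler_sign.
have iB : << simplex_face i (path_simplex f) >> \in subchain B (n := 0).
  apply: subchainU => v; rewrite /simplex_face /= /mkcts /bary /= mxE.
  have [_] := baryP v; rewrite big_ord1 => v1.
  case: unliftP => [k _|_]; last by rewrite clamp0 // path_zero.
  by rewrite (ord1 k) [X in clamp X]v1 clamp1 // path_one.
by case: odd; rewrite ?rpredN.
Qed.

Definition path_cycle (a b : set_type B)
    (f : {path I from \val a to \val b}) : sing_homology R B 1 :=
  \pi_(sing_homology R B 1)
     (Cycle (path_simplex_cycle f (set_valP a) (set_valP b))).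

End PathCycle.

Section Covering.
Context {E X : topologicalType} (p : E -> X).

Definition homeo_on (V : set E) (U : set X) : Prop :=
  {within V, continuous p} /\ exists q : X -> E,
    [/\ {within U, continuous q}, set_fun V U p, set_fun U V q,
        {in V, cancel p q} & {in U, cancel q p}].

Definition evenly_covered (U : set X) : Prop :=
  exists S : set (set E),
    [/\ p @^-1` U = \bigcup_(V in S) V,
        forall V, S V -> open V,
        forall V W, S V -> S W -> V `&` W !=set0 -> V = W &
        forall V, S V -> homeo_on V U].

Definition covering_map : Prop :=
  continuous p /\
  forall x, exists U, [/\ open U, U x & evenly_covered U].

End Covering.

(* Connectedness of the spaces is meant in this sense: the fundamental groupoid
   and singular homology only see path components. *)
Definition path_connected (R : realType) (X : topologicalType) : Prop :=
  forall x y : X, inhabited {path (I01 R) from x to y}.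

Section Determined.
Context {R : realType} {E X : topologicalType}.
Variables (p : E -> X) (cp : continuous p) (x : X).

Definition determined_by (N : normal_subgroup (pi1 R x)) : Prop :=
  exists (e : E) (pe : p e = x),
    forall u : pi1 R x, N u <-> exists v : pi1 R e, pc_map cp pe pe v = u.

End Determined.

(* Main.v *)
From HB Require Import structures.
From mathcomp Require Import generic_quotient ring_quotient freeg.
Require Import Defs.
From mathcomp Require Import all_boot all_order all_algebra.
From mathcomp Require Import all_classical all_reals topology normedtype.
From mathcomp Require Import continuous_path.
From mathcomp Require Import lra.

(** Covering space theory identifies the fundamental groupoid of the covering
    space on a fibre.  Loops at [x] act on the fibre over [x] by lifting; the
    stabiliser of a suitable point [e] of the fibre is [N], and since the
    covering space is path connected the fibre becomes [F / N], the objects of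
    the pullback.  A path class between points of the fibre is determined by
    its image in [F] together with its end point ([pc_map_inj]), and every
    element of [F] lifts to such a class ([fiber_lift]); this is the statement
    that [theta] is an isomorphism of groupoids ([theta_iso]).

    The covering space enters only through unique lifting of paths and of
    homotopies.  Both are derived from one principle,
    [locally_constant_connected]: a predicate that is locally constant on a
    connected set is constant there.  It is applied to the agreement of two
    lifts, to the existence of a lift on an initial segment, and to the
    continuity, at a given parameter, of a family of lifts.

    The isomorphism with homology ([totab_homology_iso]) is a relative form of
    the Hurewicz theorem for a pair [(Y, B)] such that every point of [Y] can be
    joined to [B] and every path inside [B] is constant.  A path is sent to its
    cycle.  For the inverse choose for each [y] a path [gamma y] to a point of
    [B], constant if [y] is in [B], and send a singular 1-simplex [s] from [y]
    to [z] to the class of [gamma y ^-1 s (gamma z)].  A 2-simplex gives a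
    relation because paths in a simplex with the same end points are homotopic.
    One composite is the identity on arrows since [gamma] is constant on [B].
    The other one changes a chain [c] by the chain of the connecting paths over
    the boundary of [c] ([totab_homology_chain]), which vanishes when the
    boundary lies in [B].  Homology classes are compared inside the cokernel of
    the boundary map, where every path has a class, closed or not.

    Finally [u |-> (u, 1)] is a universal derivation into the total
    abelianisation ([totab_universal_derivation]): a derivation [e] extends to
    arrows by [(u, g) |-> e(u)^g], and the derivation rule says precisely that
    this respects composition. *)

Set Implicit Arguments.
Unset Strict Implicit.
Unset Printing Implicit Defensive.

Import Order.TTheory GRing.Theory Num.Theory.
Import numFieldNormedType.Exports.

Local Open Scope classical_set_scope.

(** * Unique lifting of paths and homotopies *)

Lemma locally_constant_connected (Z : topologicalType) (D : set Z)
    (P : Z -> Prop) :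
  connected D ->
  (forall z, D z -> \forall y \near z, D y -> (P y <-> P z)) ->
  forall a b, D a -> D b -> P a -> P b.
Proof.
move=> cD lcP a b Da Db Pa.
suff DP : D `&` P = D by move: Db; rewrite -DP; case.
apply: cD; first by exists a.
  exists [set y | D y -> P y]^°; first exact: open_interior.
  apply/seteqP; split=> z [Dz Pz]; split=> //; last exact: (interior_subset Pz).
  by have := lcP z Dz; apply: filterS => y yP /yP yz; exact/yz.
exists (~` [set y | D y -> ~ P y]^°); first exact/open_closedC/open_interior.
apply/seteqP; split=> z [Dz Pz]; split=> //.
  by move=> /interior_subset; exact.
apply: contrapT => nPz; apply: Pz.
by have := lcP z Dz; apply: filterS => y yP /yP yz; move/yz.
Qed.

Lemma continuous_slice (Y Z : topologicalType) (b : Y) :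
  continuous (fun z : Z => (z, b)).
Proof.
have cid : continuous (fun z : Z => z) by move=> z; exact: cvg_id.
have cb : continuous (fun _ : Z => b) by move=> z; exact: cvg_cst.
exact: (cont_pair cid cb).
Qed.

Local Open Scope ring_scope.

Lemma ball_connected (R : realType) (s eps : R) : connected (ball s eps).
Proof.
apply/connected_intervalP => a b; rewrite -!ball_normE /= !ltr_norml.
move=> /andP[_ sa] /andP[sb _] c /andP[ac cb]; rewrite /= ltr_norml.
apply/andP; split; [apply: lt_le_trans sb _|apply: le_lt_trans sa];
  by rewrite lerD2l lerN2.
Qed.

Local Close Scope ring_scope.

Section Covering.
Local Open Scope ring_scope.
Context {R : realType} {E X : topologicalType}.
Variables (p : E -> X) (hp : covering_map p).

(** A pointwise repackaging of evenly covered neighbourhoods: through each point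
    over [U] passes a sheet [V] with a section [q] of [p] onto it, and [V] is
    both open and closed in the preimage of [U]. *)
Lemma covering_sheets (x : X) : exists U : set X, [/\ open U, U x &
  forall e, U (p e) -> exists (V : set E) (q : X -> E),
    [/\ V e, forall y, V y -> q (p y) = y,
        forall w, U w -> V (q w) /\ p (q w) = w,
        forall w, U w -> q y @[y --> w] --> q w &
        forall e', U (p e') -> \forall y \near e', V y <-> V e']].
Proof.
have [cp /(_ x) [U [oU Ux [S [SU oS dS hS]]]]] := hp.
exists U; split=> // e Ue.
have preE e' : U (p e') -> exists2 V, S V & V e'.
  move=> Ue'; have : (p @^-1` U) e' by [].
  by rewrite SU => -[V SV Ve']; exists V.
have [V SV Ve] := preE e Ue; have [_ [q [cq Up Vq pq qp]]] := hS V SV.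
exists V, q; split=> //.
- by move=> y Vy; rewrite pq // inE.
- by move=> w Uw; split; [exact: Vq|rewrite qp // inE].
- move=> w Uw; move: cq; rewrite continuous_open_subspace //; apply.
  by rewrite inE.
- move=> e' Ue'; have [V' SV' Ve'] := preE e' Ue'.
  have : nbhs e' V' by apply: open_nbhs_nbhs; split=> //; exact: oS.
  apply: filterS => y V'y; split=> [Vy|Ve'2].
    by rewrite (dS V V') //; exists y.
  by rewrite (dS V V') //; exists e'.
Qed.

(** Two lifts of the same map agree near a point or differ near that point, so
    on a connected set they agree everywhere or nowhere. *)
Lemma lift_unique (Z : topologicalType) (D : set Z) (g h : Z -> E) :
  connected D -> continuous g -> continuous h ->
  (forall z, D z -> p (g z) = p (h z)) ->
  forall a b, D a -> D b -> g a = h a -> g b = h b.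
Proof.
move=> cD cg ch gh.
apply: (locally_constant_connected (P := fun z => g z = h z)) => // z Dz.
have [U [oU Uz /(_ (g z) Uz) [V [q [Vgz qK _ _ Vlc]]]]] :=
  covering_sheets (p (g z)).
have Uhz : U (p (h z)) by rewrite -gh.
have nVg : \forall y \near z, V (g y) <-> V (g z) by exact: cg z _ (Vlc _ Uz).
have nVh : \forall y \near z, V (h y) <-> V (h z) by exact: ch z _ (Vlc _ Uhz).
move: nVh nVg; apply: filterS2 => y Vh Vg Dy.
have Vgy : V (g y) by exact/Vg.
split=> [e|e].
  have Vhz : V (h z) by apply/Vh; rewrite -e.
  by rewrite -(qK _ Vgz) -(qK _ Vhz) gh.
have Vhy : V (h y) by apply/Vh; rewrite -e.
by rewrite -(qK _ Vgy) -(qK _ Vhy) gh.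
Qed.

(** The set of times up to which a lift exists is locally constant: on an
    evenly covered stretch a lift is prolonged by the section of the sheet that
    it has reached. *)
Lemma path_lifting (f : R -> X) (e : E) : continuous f -> p e = f 0 ->
  exists g : R -> E, [/\ continuous g, g 0 = e &
    forall s, 0 <= s <= 1 -> p (g s) = f s].
Proof.
move=> cf pe.
pose P (t : R) := exists g : R -> E, [/\ continuous g, g 0 = e &
  forall s, 0 <= s <= t -> p (g s) = f s].
suff : P 1 by [].
have P0 : P 0.
  exists (fun=> e); split=> // [z|s s0]; first exact: cvg_cst.
  by rewrite pe; congr f; exact/le_anti.
have D0 : `[0, 1]%classic (0 : R) by rewrite /= in_itv /= lexx ler01.
have D1 : `[0, 1]%classic (1 : R) by rewrite /= in_itv /= lexx ler01.
apply: (locally_constant_connected (P := P) _ _ D0 D1 P0).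
  exact: segment_connected.
move=> z Dz; have [U [oU Uz sheetU]] := covering_sheets (f z).
have [eps /= eps0 nU] : \forall y \near z, U (f y).
  by apply: (cf z); apply: open_nbhs_nbhs; split.
have step a b : `|z - a| < eps -> `|z - b| < eps -> 0 <= a -> P a -> P b.
  move=> za zb a0 [g [cg g0 gf]].
  have [ba|/ltW ab] := leP b a.
    exists g; split=> // s /andP[s0 sb]; apply: gf.
    by rewrite s0 (le_trans sb).
  have Ufa : U (p (g a)) by rewrite gf ?a0 ?lexx //; exact: nU.
  have [V [q [Vga qK Vq cq _]]] := sheetU _ Ufa.
  (* Clamping to [a, b] keeps the argument inside the evenly covered ball. *)
  pose m (s : R) := Num.max a (Num.min s b).
  have cm : continuous m.
    apply: maxr_continuous; first by move=> s; exact: cvg_cst.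
    by apply: minr_continuous => s; [exact: cvg_id|exact: cvg_cst].
  have Ufm (s : R) : U (f (m s)).
    have am : a <= m s by rewrite le_max lexx.
    have mb : m s <= b by rewrite ge_max ab ge_min lexx orbT.
    apply: nU; move: za zb; rewrite /= !ltr_norml => /andP[_ za] /andP[zb _].
    by apply/andP; split; [apply: lt_le_trans zb _|apply: le_lt_trans za];
      rewrite lerD2l lerN2.
  exists (fun s : R => if s <= a then g s else q (f (m s))); split.
  - apply: (@glue_continuous R R E id a g (fun s => q (f (m s)))) => //.
    + by move=> s; exact: cvg_id.
    + move=> s; apply: (@continuous_comp _ _ _ m (fun w => q (f w))).
        exact: cm.
      by apply: (@continuous_comp _ _ _ f q); [exact: cf|exact: (cq _ (Ufm s))].
    + by move=> s ->; rewrite /m (min_idPl ab) maxxx -gf ?a0 ?lexx // qK.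
  - by rewrite a0.
  - move=> s /andP[s0 sb]; case: leP => sa; first by apply: gf; rewrite s0.
    rewrite (Vq _ (Ufm s)).2 /m (min_idPl sb) (max_idPr _) //; exact: ltW.
exists eps => //= y zy Dy.
have zz : `|z - z| < eps by rewrite subrr normr0.
move: Dy Dz; rewrite !in_itv /= => /andP[y0 _] /andP[z0 _].
by split; exact: step.
Qed.

(** Near a point, the lifts that start in one sheet at some time stay in it, and
    so coincide with the composite of the section and [H].  Hence continuity of
    [K] at [(z0, s)] follows from continuity of the single slice at any nearby
    time, and it spreads from time [0] to all times. *)
Lemma lift_family_continuous (Z : topologicalType) (H : Z * R -> X)
    (K : Z -> R -> E) :
  continuous H -> (forall z, continuous (K z)) ->
  (forall z s, p (K z s) = H (z, s)) -> continuous (K ^~ 0) ->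
  continuous (fun zs => K zs.1 zs.2).
Proof.
move=> cH cK KH cK0 [z0 s1] /=.
pose P (s : R) := K z s @[z --> z0] --> K z0 s.
have local_step (s0 : R) : exists2 eps : R, 0 < eps & forall a b,
    ball s0 eps a -> ball s0 eps b -> P a ->
    K zs.1 zs.2 @[zs --> (z0, b)] --> K z0 b.
  have [U [oU Uz sheetU]] := covering_sheets (H (z0, s0)).
  have nU : nbhs (H (z0, s0)) U by apply: open_nbhs_nbhs; split.
  have [[W J] /= [nW [eps /= eps0 epsJ]] WJ] := cH _ _ nU.
  have WU z s : W z -> ball s0 eps s -> U (H (z, s)).
    by move=> Wz /epsJ Js; apply: (WJ (z, s)).
  have Wz0 : W z0 by exact: nbhs_singleton.
  exists eps => // a b Ba Bb Pa.
  have Ua : U (p (K z0 a)) by rewrite KH; exact: WU.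
  have [V [q [Va qK _ cq Vlc]]] := sheetU _ Ua.
  have nV : \forall z \near z0, V (K z a) <-> V (K z0 a)
    by exact: (Pa _ (Vlc _ Ua)).
  have Kq z s : W z -> (V (K z a) <-> V (K z0 a)) -> ball s0 eps s ->
      K z s = q (H (z, s)).
    move=> Wz /iffRL /(_ Va) Vza Bs; rewrite -KH qK //.
    apply: (locally_constant_connected (P := fun s => V (K z s)) _ _ Ba Bs) => //.
      exact: ball_connected.
    move=> t Bt; have Ut : U (p (K z t)) by rewrite KH; exact: WU.
    have : \forall y \near t, V (K z y) <-> V (K z t)
      by exact: (cK z t _ (Vlc _ Ut)).
    by apply: filterS => y ? _.
  have qH : q (H zs) @[zs --> (z0, b)] --> q (H (z0, b)).
    apply: (@continuous_comp _ _ _ H q); first exact: cH.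
    exact: (cq _ (WU _ _ Wz0 Bb)).
  rewrite (Kq z0 b) // => N /qH nN.
  have nB : nbhs b (ball s0 eps)
    by apply: open_nbhs_nbhs; split=> //; exact: ball_open.
  have nWV : nbhs z0 (W `&` [set z | V (K z a) <-> V (K z0 a)])
    by exact: filterI.
  have nWB : nbhs (z0, b)
      ((W `&` [set z | V (K z a) <-> V (K z0 a)]) `*` ball s0 eps).
    by exists (W `&` [set z | V (K z a) <-> V (K z0 a)], ball s0 eps).
  by move: nWB nN; apply: filterS2 => -[z s] /= [[Wz Vz] Bs]; rewrite Kq.
have slice b : K zs.1 zs.2 @[zs --> (z0, b)] --> K z0 b -> P b.
  move=> c; apply: (@continuous_comp _ _ _ (fun z => (z, b))
    (fun zs => K zs.1 zs.2)) => //.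
  exact: continuous_slice.
have [eps eps0 step] := local_step s1.
suff Ps1 : P s1 by apply: step Ps1; exact: ballxx.
have cT : connected [set: R] by apply/connected_intervalP.
apply: (@locally_constant_connected _ _ P cT _ 0 s1) => //; last exact: cK0.
move=> s _; have [d d0 dstep] := local_step s; exists d => //= t st _.
by split=> Pt; apply: slice; apply: dstep Pt => //; exact: ballxx.
Qed.

Local Notation I := (I01 R).
Local Notation pmap := (Defs.path_map hp.1).
Local Notation cmap := (pc_map (R := R) hp.1).

Lemma path_lift_unique (f g : I -> E) :
  continuous f -> continuous g -> (forall t, p (f t) = p (g t)) ->
  f zero = g zero -> f =1 g.
Proof.
move=> cf cg fg fg0 t; rewrite -[t]clampK.
have cT : connected [set: R] by apply/connected_intervalP.
have cc h : continuous h -> continuous (fun s : R => h (clamp s) : E).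
  by move=> ch; apply: cont_comp => //; exact: clamp_continuous.
apply: (lift_unique cT (cc f cf) (cc g cg) _ (a := 0)) => //=; rewrite clamp0.
Qed.

(** Stated as an equality of paths with fixed end points, so that it can be
    passed to path classes. *)
Lemma path_lift x y (f : {path I from x to y}) (a : E) (pa : p a = x) :
  exists b (pb : p b = y) (g : {path I from a to b}), pmap pa pb g = f.
Proof.
have cf : continuous (fun s : R => f (clamp s)).
  by apply: cont_comp; [exact: cts_fun|exact: clamp_continuous].
have [|g [cg g0 gf]] := path_lifting cf (e := a).
  by rewrite clamp0 // path_zero.
have cG : continuous (fun t : I => g (ival t))
  by exact: cont_comp (@ival_continuous R).
have pG t : p (g (ival t)) = f t by rewrite gf ?ivalP // clampK.
have pb : p (g 1) = y by rewrite -(path_one (s := f)) -pG ival1.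
have G0 : g (ival zero) = a by rewrite ival0.
have G1 : g (ival one) = g 1 by rewrite ival1.
exists (g 1), pb, (mk_path cG G0 G1); apply/path_eqP => t; exact: pG.
Qed.

(** The lifts of the slices of the homotopy form a continuous family; the first
    and last slices are [f] and [g] by uniqueness, and the end points move
    continuously over the constant [y], so they do not move at all. *)
Lemma homotopy_lift x y a b b' (pa : p a = x) (pb : p b = y) (pb' : p b' = y)
    (f : {path I from a to b}) (g : {path I from a to b'}) :
  path_homotopic (pmap pa pb f) (pmap pa pb' g) ->
  exists K : I * I -> E,
    [/\ continuous K, forall s, K (s, zero) = f s, forall s, K (s, one) = g s,
        forall t, K (zero, t) = a & forall t, K (one, t) = b].
Proof.
move=> [H [cH Hf Hg Hx Hy]].
have /choice[k kP] (t : I) : exists g : R -> E, [/\ continuous g, g 0 = a &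
    forall s, 0 <= s <= 1 -> p (g s) = H (clamp s, t)].
  apply: path_lifting; last by rewrite clamp0 // Hx.
  apply: cont_comp => //; apply: cont_pair; first exact: clamp_continuous.
  exact: cst_continuous.
(* The lifts cover H on the unit interval only; clamping makes them lifts for
   all real times. *)
pose K (t : I) (s : R) := k t (ival (clamp s)).
have cKt t : continuous (K t).
  have [ck _ _] := kP t; apply: cont_comp => //.
  exact: cont_comp (@ival_continuous R) (@clamp_continuous R).
have pK t s : p (K t s) = H (clamp s, t).
  by have [_ _ kH] := kP t; rewrite /K kH ?ivalP // clampK.
have K0 t : K t 0 = a
  by have [_ k0 _] := kP t; rewrite /K ival_clamp ?lexx ?ler01.
have cK : continuous (fun ts : I * R => K ts.1 ts.2).
  apply: (@lift_family_continuous I (fun ts => H (clamp ts.2, ts.1))) => //.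
    apply: cont_comp => //; apply: cont_pair; last exact: cont_fst.
    by apply: cont_comp; [exact: clamp_continuous|exact: cont_snd].
  have -> : K^~ 0 = fun=> a by exact/funext.
  exact: cst_continuous.
have cKi t : continuous (fun s : I => K t (ival s)).
  exact: cont_comp (cKt t) (@ival_continuous R).
have Kf s : K zero (ival s) = f s.
  apply: (@path_lift_unique (fun s => K zero (ival s)) f) => //.
  - exact: cts_fun.
  - by move=> t; rewrite pK clampK Hf.
  - by rewrite ival0 K0 path_zero.
have Kg s : K one (ival s) = g s.
  apply: (@path_lift_unique (fun s => K one (ival s)) g) => //.
  - exact: cts_fun.
  - by move=> t; rewrite pK clampK Hg.
  - by rewrite ival0 K0 path_zero.
have K1 t : K t 1 = b.
  apply: (@path_lift_unique (K^~ 1) (fun=> b)).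
  - apply: (@cont_comp _ _ _ (fun ts : I * R => K ts.1 ts.2)
      (fun t => (t, 1))) => //.
    exact: continuous_slice.
  - exact: cst_continuous.
  - by move=> s; rewrite pK clamp1 // Hy pb.
  - by rewrite -ival1 Kf path_one.
exists (fun st => K st.2 (ival st.1)); split=> //= [|t|t].
- apply: (cont_comp cK (f := fun st : I * I => (st.2, ival st.1))).
  apply: cont_pair; first exact: cont_snd.
  by apply: cont_ival; exact: cont_fst.
- by rewrite ival0.
- by rewrite ival1.
Qed.

Lemma lift_end_unique x y a b b' (pa : p a = x) (pb : p b = y) (pb' : p b' = y)
    (u : path_class R a b) (v : path_class R a b') :
  cmap pa pb u = cmap pa pb' v -> b = b'.
Proof.
have [f ->] := pclP u; have [g ->] := pclP v; rewrite !pc_mapE => /path_classP.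
move=> /homotopy_lift[K [_ _ Kg _ Kb]].
by rewrite -(Kb one) Kg path_one.
Qed.

Lemma pc_map_inj x y a b (pa : p a = x) (pb : p b = y) :
  injective (cmap pa pb).
Proof.
move=> u v; have [f ->] := pclP u; have [g ->] := pclP v.
by rewrite !pc_mapE => /path_classP /homotopy_lift ?; exact/path_classP.
Qed.

End Covering.

(** * The action on the fibre and the groupoid isomorphism *)

Section PathClassMap.
Context {R : realType} {T U : topologicalType} (p : T -> U) (cp : continuous p).
Local Notation cmap := (pc_map (R := R) cp).

Lemma pc_map_comp a b c x y z (pa : p a = x) (pb : p b = y) (pc : p c = z)
    (u : path_class R a b) (v : path_class R b c) :
  cmap pa pc (pc_comp u v) = pc_comp (cmap pa pb u) (cmap pb pc v).
Proof.
have [f ->] := pclP u; have [g ->] := pclP v.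
rewrite pc_compE !pc_mapE pc_compE; congr pcl; apply/path_eqP => t.
rewrite /= /mk_path /= /path_cat_fun /=.
by case: ifP.
Qed.

Lemma pc_map_inv a b x y (pa : p a = x) (pb : p b = y) (u : path_class R a b) :
  cmap pb pa (pc_inv u) = pc_inv (cmap pa pb u).
Proof.
have [f ->] := pclP u; rewrite pc_invE !pc_mapE pc_invE.
by congr pcl; apply/path_eqP.
Qed.

Lemma pc_map_id a x (pa : p a = x) : cmap pa pa (pc_id a) = pc_id x.
Proof. by rewrite pc_mapE; congr pcl; exact/path_eqP. Qed.

End PathClassMap.

Section FiberAction.
Context {R : realType} {E X : topologicalType}.
Variables (p : E -> X) (hp : covering_map p).
Variable (x : X).
Local Open Scope group_scope.
Local Notation X0 := (p @^-1` [set x]).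
Local Notation cmap a b := (pc_map (R := R) hp.1 (set_valP a) (set_valP b)).

Lemma fiber_lift (u : pi1 R x) (b : X0) :
  exists (a : X0) (v : path_class R (\val a) (\val b)), cmap a b v = u.
Proof.
have [f uf] := pclP (pc_inv u).
have [a [pa [g gf]]] := path_lift hp f (set_valP b).
have aX0 : a \in X0 by rewrite inE.
pose a' : X0 := exist _ a aX0; exists a'.
exists (pc_inv (pcl g : path_class R (\val b) (\val a'))).
rewrite (pc_map_inv hp.1 (set_valP b) (set_valP a')) -[RHS]pc_invK uf.
congr pc_inv.
by rewrite pc_mapE -gf; congr pcl; apply/path_eqP.
Qed.

(** The left action of the fundamental group on the fibre: transport
    backwards along a loop, so that it matches the source of an arrow. *)
Definition fiber_act (u : pi1 R x) (b : X0) : X0 := sval (cid (fiber_lift u b)).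

Lemma fiber_actP u b :
  exists v : path_class R (\val (fiber_act u b)) (\val b),
    cmap (fiber_act u b) b v = u.
Proof. exact: (svalP (cid (fiber_lift u b))). Qed.

Lemma fiber_actE (a b : X0) (v : path_class R (\val a) (\val b)) :
  fiber_act (cmap a b v) b = a.
Proof.
have [w wv] := fiber_actP (cmap a b v) b; apply: val_inj.
apply: (lift_end_unique (hp := hp) (pa := set_valP b) (u := pc_inv w)
  (v := pc_inv v) (pb := set_valP (fiber_act (cmap a b v) b))
  (pb' := set_valP a)).
by rewrite !pc_map_inv wv.
Qed.

Lemma fiber_act1 b : fiber_act 1 b = b.
Proof. by rewrite -[1](pc_map_id hp.1 (set_valP b)) fiber_actE. Qed.

Lemma fiber_actM u v b : fiber_act (u * v) b = fiber_act u (fiber_act v b).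
Proof.
move: (fiber_act v b) (fiber_actP v b) => c [w <-].
move: (fiber_act u c) (fiber_actP u c) => a [t <-].
rewrite -[_ * _](pc_map_comp hp.1 (set_valP a) (set_valP c) (set_valP b) t w).
exact: fiber_actE.
Qed.

End FiberAction.

Section Theta.
Context {R : realType} {E X : topologicalType}.
Variables (p : E -> X) (hp : covering_map p).
Hypothesis hE : path_connected R E.
Variables (x : X) (N : normal_subgroup (pi1 R x)).
Local Open Scope group_scope.
Local Notation X0 := (p @^-1` [set x]).
Local Notation cmap a b := (pc_map (R := R) hp.1 (set_valP a) (set_valP b)).
Local Notation phi := (@quot_mor (pi1 R x) N).
Local Notation act := (fiber_act hp).
Variable (e : X0).
Hypothesis eN : forall u, N u <-> act u e = e.

Definition theta_obj (g : Fhat phi) : X0 := act (repr (g : quot_group N)) e.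

(** This is where the normal subgroup being the stabiliser of [e] is used: the
    orbit of [e] is the set of cosets. *)
Lemma act_quot_mor u v : act u e = act v e <-> phi u = phi v.
Proof.
rewrite quot_morP eN fiber_actM; split=> [<-|/(congr1 (act u))].
  by rewrite -fiber_actM mulVg fiber_act1.
by rewrite -fiber_actM mulgV fiber_act1.
Qed.

Lemma theta_objE u : theta_obj (phi u) = act u e.
Proof. by apply/act_quot_mor; rewrite quot_morK. Qed.

Lemma theta_obj_act u g : theta_obj (phi u * g) = act u (theta_obj g).
Proof.
by have [v ->] := quot_morS g; rewrite -quot_morM !theta_objE fiber_actM.
Qed.

Lemma theta_obj_inj : injective theta_obj.
Proof.
move=> g h; have [u ->] := quot_morS g; have [v ->] := quot_morS h.
by rewrite !theta_objE => /act_quot_mor.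
Qed.

Lemma theta_hom_subproof (a b : Fhat phi) (u : ghom a b) :
  exists v : path_class R (\val (theta_obj a)) (\val (theta_obj b)),
    cmap (theta_obj a) (theta_obj b) v = Fhat_proj u.
Proof.
case: u => u uP; rewrite /Fhat_proj /=.
have -> : theta_obj a = act u (theta_obj b) by rewrite -theta_obj_act (eqP uP).
exact: fiber_actP.
Qed.

Definition theta_hom (a b : Fhat phi) (u : ghom a b) :=
  sval (cid (theta_hom_subproof u)).

Lemma theta_homE (a b : Fhat phi) (u : ghom a b) :
  cmap (theta_obj a) (theta_obj b) (theta_hom u) = Fhat_proj u.
Proof. exact: (svalP (cid (theta_hom_subproof u))). Qed.

Lemma theta_id (a : Fhat phi) :
  theta_hom (gid a) = @gid (fund_groupoid R X0) (theta_obj a).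
Proof.
apply: (pc_map_inj (hp := hp) (pa := set_valP (theta_obj a))
  (pb := set_valP (theta_obj a))).
by rewrite theta_homE pc_map_id.
Qed.

Lemma theta_comp (a b c : Fhat phi) (u : ghom a b) (v : ghom b c) :
  theta_hom (gcomp u v)
  = @gcomp (fund_groupoid R X0) _ _ _ (theta_hom u) (theta_hom v).
Proof.
apply: (pc_map_inj (hp := hp) (pa := set_valP (theta_obj a))
  (pb := set_valP (theta_obj c))).
rewrite (pc_map_comp hp.1 (set_valP (theta_obj a)) (set_valP (theta_obj b))
  (set_valP (theta_obj c))).
by rewrite !theta_homE.
Qed.

Definition theta : gfunctor (Fhat phi) (fund_groupoid R X0) :=
  @GFunctor (Fhat phi) (fund_groupoid R X0) theta_obj theta_hom
    theta_id theta_comp.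

(** Surjectivity on objects is path connectedness of the covering space; on
    morphisms it holds because the two end points of a lift force the coset
    condition on its image, by injectivity on objects. *)
Lemma theta_iso : groupoid_iso theta.
Proof.
split=> [|a b]; rewrite -setTT_bijective.
  split=> // [g h _ _|b _]; first exact: theta_obj_inj.
  have [f] := hE (\val b) (\val e); exists (phi (cmap b e (pcl f))) => //.
  by rewrite /= theta_objE fiber_actE.
split=> // [u v _ _ /= uv|v _].
  by apply: val_inj; rewrite -[LHS]theta_homE -[RHS]theta_homE uv.
have vP : phi (cmap (theta_obj a) (theta_obj b) v) * b == a.
  by apply/eqP/theta_obj_inj; rewrite theta_obj_act fiber_actE.
exists (exist _ (cmap (theta_obj a) (theta_obj b) v) vP : Fhat_hom phi a b)
  => //.
apply: (pc_map_inj (hp := hp) (pa := set_valP (theta_obj a))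
  (pb := set_valP (theta_obj b))).
by rewrite theta_homE.
Qed.

End Theta.

(** * Total abelianisations and universal derivations *)

(** Arrows with equal end points can be compared directly, by irrelevance of
    the proofs used to transport along equalities of objects. *)
Lemma Arrow_inj (H : groupoid) (a b : H) : injective (@Arrow H a b).
Proof.
pose cast (x : arrow H) (ea : asrc x = a) (eb : atgt x = b) : ghom a b :=
  ecast d (ghom a d) eb (ecast c (ghom c (atgt x)) ea (ahom x)).
have castE x y (xy : x = y) ea eb ea' eb' : @cast x ea eb = @cast y ea' eb'.
  case: _ / xy ea' eb' => ea' eb'.
  by rewrite (Prop_irrelevance ea ea') (Prop_irrelevance eb eb').
by move=> u v uv; exact: (castE _ _ uv erefl erefl erefl erefl).
Qed.

Section TotabArrows.
Context (H : groupoid) (V : zmodType) (f : arrow H -> V).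
Hypothesis fM : to_abelian f.
Local Open Scope ring_scope.

Lemma to_abelian_id (a : H) : f (Arrow (gid a)) = 0.
Proof. by apply: (addrI (f (Arrow (gid a)))); rewrite -fM gid_comp addr0. Qed.

Lemma to_abelian_inv (a b : H) (u : ghom a b) :
  f (Arrow (ginv u)) = - f (Arrow u).
Proof.
by apply: (addrI (f (Arrow u))); rewrite -fM gcompV to_abelian_id subrr.
Qed.

End TotabArrows.

Section TotabIso.
Context (H K : groupoid) (F : gfunctor H K) (isoF : groupoid_iso F).

Lemma map_arrow_bij : bijective (map_arrow F).
Proof.
have [bF bh] := isoF; rewrite -setTT_bijective; split=> // [x y _ _|y _].
  case: x => a b u; case: y => a' b' v uv.
  have ea : a = a' by apply: (bij_inj bF); exact: (congr1 (@asrc K) uv).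
  have eb : b = b' by apply: (bij_inj bF); exact: (congr1 (@atgt K) uv).
  case: _ / ea v uv => v; case: _ / eb v => v uv.
  congr Arrow; apply: (bij_inj (bh a b)).
  exact: (Arrow_inj uv).
have [iF _ FK] := bF.
case: y => c d w; rewrite -(FK c) -(FK d) in w *.
have [ih _ hK] := bh (iF c) (iF d).
by exists (Arrow (ih w)) => //; rewrite /map_arrow /= hK.
Qed.

(** The inverse is built on arrows rather than from an inverse functor, which
    would require transports between morphism sets. *)
Lemma totab_iso_exists : exists z : zmod_iso (totab H) (totab K),
  forall x, z (totab_in x) = totab_in (map_arrow F x).
Proof.
have [i iK Ki] := map_arrow_bij.
have iM : to_abelian (fun y => totab_in (i y)).
  have [[iF _ FK] bh] := isoF.
  move=> a b c; rewrite -(FK a) -(FK b) -(FK c) => u v.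
  have [iu _ uK] := bh (iF a) (iF b); have [iv _ vK] := bh (iF b) (iF c).
  rewrite -(uK u) -(vK v) -fhom_comp.
  have iE a' b' (w : @ghom H a' b') : i (Arrow (fhom F w)) = Arrow w.
    exact: (iK (Arrow w)).
  by rewrite !iE totab_in_comp.
have mapE x : totab_map F (totab_in x) = totab_in (map_arrow F x).
  exact: totab_liftE.
have funK : cancel (totab_map F) (totab_lift iM).
  apply: (@totab_ext _ _ (totab_lift iM \o totab_map F) idfun) => // [|x].
    exact: raddfB.
  by rewrite /= mapE totab_liftE iK.
have invK : cancel (totab_lift iM) (totab_map F).
  apply: (@totab_ext _ _ (totab_map F \o totab_lift iM) idfun) => // [|x].
    exact: raddfB.
  by rewrite /= totab_liftE mapE Ki.
by exists (ZmodIso (@raddfB _ _ (totab_map F)) funK invK).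
Qed.

End TotabIso.

Lemma zmod_iso_comp (U V W : zmodType) (y : zmod_iso U V) (z : zmod_iso V W) :
  exists t : zmod_iso U W, forall u, t u = z (y u).
Proof.
have tB : zmod_morphism (z \o y) by move=> u v /=; rewrite iso_funB iso_funB.
have tK : cancel (z \o y) (iso_inv y \o iso_inv z).
  by move=> u; rewrite /= !iso_funK.
have Kt : cancel (iso_inv y \o iso_inv z) (z \o y).
  by move=> w; rewrite /= !iso_invK.
by exists (@ZmodIso _ _ (z \o y) _ tB tK Kt).
Qed.

Lemma ractB (G : groupType) (M : rmodule G) (g : G) :
  zmod_morphism (fun m : M => ract m g).
Proof.
by move=> m n; apply: (addIr (ract n g)); rewrite -ractD !subrK.
Qed.

Section UniversalDerivation.
Variables (F G : groupType) (phi : {multiplicative F -> G}).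
Local Open Scope group_scope.

(** The pair [(u, g)] of the pullback groupoid, with its source computed. *)
Definition Fhat_arrow (u : F) (g : G) : arrow (Fhat phi) :=
  @Arrow (Fhat phi) (phi u * g) g (exist _ u (eqxx _)).

Lemma Fhat_arrowE (a b : Fhat phi) (u : ghom a b) :
  Arrow u = Fhat_arrow (\val (u : Fhat_hom phi a b)) b.
Proof. exact: Fhat_arrow_eq. Qed.

Lemma Fhat_act_arrow u g k :
  Fhat_act (totab_in (Fhat_arrow u g)) k = totab_in (Fhat_arrow u (g * k)).
Proof.
rewrite /Fhat_act /totab_map totab_liftE /=; congr totab_in.
exact: Fhat_arrow_eq.
Qed.

Lemma totab_in_arrowM u v g :
  totab_in (Fhat_arrow (u * v) g)
  = (totab_in (Fhat_arrow u (phi v * g)) + totab_in (Fhat_arrow v g))%R.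
Proof.
rewrite /Fhat_arrow.
have e : phi u * (phi v * g) = phi (u * v) * g by rewrite gmulfM mulgA.
rewrite -totab_in_comp; congr totab_in; exact: Fhat_arrow_eq.
Qed.

(** Uniqueness holds because [(u, g)] is the translate by [g] of [(u, 1)], so
    that the values of the derivation generate the module. *)
Lemma totab_universal_derivation :
  universal_derivation phi (D := Fhat_module phi)
    (fun u => totab_in (Fhat_arrow u 1)).
Proof.
split=> [u v|M e eD].
  by rewrite totab_in_arrowM mulg1 /= Fhat_act_arrow mul1g.
pose f (x : arrow (Fhat phi)) : M := ract (e (Fhat_proj (ahom x))) (atgt x).
have fM : to_abelian f.
  move=> a b c [u uP] [v vP]; rewrite /f /= eD ractD -ractM; congr (_ + _)%R.
  by rewrite /= (eqP vP).
exists (totab_lift fM); split.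
  split=> [|u]; last by rewrite totab_liftE /f /= ract1.
  split=> [|m g]; first exact: raddfB.
  apply: (@totab_ext _ _ (fun m => totab_lift fM (Fhat_act m g))
                         (fun m => ract (totab_lift fM m) g)).
  - by move=> m1 m2; rewrite /Fhat_act !raddfB.
  - by move=> m1 m2; rewrite raddfB ractB.
  move=> [a b u]; rewrite Fhat_arrowE Fhat_act_arrow !totab_liftE /f /=.
  exact: ractM.
move=> h [[hB hG] he]; apply/funext.
apply: totab_ext => //; first exact: raddfB.
move=> [a b u]; rewrite Fhat_arrowE totab_liftE /f /=.
rewrite -he -hG /=; congr h.
by rewrite Fhat_act_arrow mul1g.
Qed.

End UniversalDerivation.

Lemma transport_universal_derivation (F G : groupType) (phi : F -> G)
    (M : rmodule G) (V : zmodType) (z : zmod_iso M V) (d : F -> M) :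
  universal_derivation phi d ->
  universal_derivation phi (D := transport_module z) (z \o d).
Proof.
move=> [dD dU]; split=> [u v|M' e eD].
  by rewrite /= dD /transport_act iso_funK raddfD.
have [f [[[fB fG] fd] f_uniq]] := dU M' e eD.
exists (f \o iso_inv z); split.
  split=> [|u]; last by rewrite /= iso_funK.
  split=> [v w|v g]; last by rewrite /= /transport_act iso_funK fG.
  rewrite /= -fB; congr f; apply: (can_inj (iso_funK z)).
  by rewrite iso_funB !iso_invK.
move=> h [[hB hG] hd].
have -> : f = h \o z.
  apply: f_uniq; split=> //; split=> [v w|v g] /=.
    by rewrite iso_funB hB.
  by rewrite -hG /= /transport_act iso_funK.
by apply/funext => v; rewrite /= iso_invK.
Qed.

(** * Homology inside a cokernel *)

Section FreeAbelianMaps.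
Context (K : choiceType) (V : zmodType).
Local Open Scope ring_scope.

Lemma freeg_unit_mulz (c : {freeg K / int}) (k : K) :
  << coeff k c *g k >> = << k >> *~ coeff k c :> {freeg K / int}.
Proof.
by apply/eqP/freeg_eqP => t; rewrite raddfMz /= !coeffU mul1r -mulrzr intz mulrC.
Qed.

Lemma freeg_ext (f g : {additive {freeg K / int} -> V}) :
  (forall k, f << k >> = g << k >>) -> f =1 g.
Proof.
move=> fg c; rewrite -[c]freeg_sumE !raddf_sum; apply: eq_bigr => k _.
by rewrite freeg_unit_mulz !raddfMz fg.
Qed.

Lemma free_lift_eq0 (f : K -> V) (c : {freeg K / int}) :
  (forall k, coeff k c != 0 -> f k = 0) -> free_lift f c = 0.
Proof.
move=> fc; rewrite -[c]freeg_sumE raddf_sum big_seq big1 // => k.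
rewrite mem_dom => /fc fk.
by rewrite freeg_unit_mulz raddfMz /= free_liftU fk mul0rz.
Qed.

End FreeAbelianMaps.

Section Coker.
Variables (A B C : zmodType) (f : {additive A -> B}) (g : {additive B -> C}).
Local Open Scope ring_scope.
Local Open Scope quotient_scope.

Definition image_pred : {pred B} := fun b => `[< exists a, f a = b >].

Lemma image_pred_closed : zmod_closed image_pred.
Proof.
split=> [|b b']; rewrite !unfold_in.
  by apply/asboolP; exists 0; rewrite raddf0.
move=> /asboolP[a <-] /asboolP[a' <-]; apply/asboolP; exists (a - a').
by rewrite raddfB.
Qed.

HB.instance Definition _ :=
  GRing.isZmodClosed.Build B image_pred image_pred_closed.

Definition coker : zmodType := Quotient.quot image_pred.

Definition coker_pi : B -> coker := \pi_(Quotient.quot image_pred).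
HB.instance Definition _ := GRing.Additive.on coker_pi.

Lemma coker_pi_eq0 b : coker_pi b = 0 <-> exists a, f a = b.
Proof.
rewrite -(raddf0 coker_pi) /coker_pi; split=> [/eqP|fb].
  by rewrite -Quotient.idealrBE subr0 unfold_in => /asboolP.
by apply/eqP; rewrite -Quotient.idealrBE subr0 unfold_in; apply/asboolP.
Qed.

Lemma homology_coker_subproof (z : cycles g) :
  z \in boundaries f (g := g) -> (coker_pi \o \val) z = 0.
Proof. by rewrite unfold_in => /asboolP fz; apply/coker_pi_eq0. Qed.

Definition homology_coker : homology f g -> coker :=
  zquot_lift homology_coker_subproof.
HB.instance Definition _ := GRing.Additive.on homology_coker.

Lemma homology_cokerE (z : cycles g) :
  homology_coker (\pi_(homology f g) z) = coker_pi (cycle_val z).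
Proof. exact: (zquot_liftE homology_coker_subproof). Qed.

(** Lets equalities of homology classes be checked in the cokernel, where chains
    that are not cycles also have a class. *)
Lemma homology_coker_inj : injective homology_coker.
Proof.
elim/quotW=> z; elim/quotW=> w; rewrite !homology_cokerE => zw.
have /coker_pi_eq0 fzw : coker_pi (\val (z - w)) = 0.
  by rewrite !raddfB; apply/eqP; rewrite subr_eq0; apply/eqP.
have : (z == w %[mod Quotient.quot (boundaries f (g := g))]).
  by rewrite -Quotient.idealrBE unfold_in; apply/asboolP.
by move=> /eqP.
Qed.

End Coker.

(** * Paths in standard simplices *)

Section StandardSimplex.
Context {R : realType}.
Local Open Scope ring_scope.
Local Notation I := (I01 R).

Lemma simplex_valued_continuous n (Z : topologicalType)
    (h : Z -> std_simplex R n) :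
  (forall i, continuous (fun z => bary (h z) ord0 i)) -> continuous h.
Proof.
move=> ch; apply: continuous_comp_initial => z U [P nP PU].
have FF : Filter (nbhs z) by apply: nbhs_filter.
have : \forall w \near z, forall j, P ord0 j (bary (h w) ord0 j).
  exact: (filter_forall FF (fun j => ch j z _ (nP ord0 j))).
by apply: filterS => w Pw; apply: PU => a j; rewrite ord1; exact: Pw.
Qed.

Lemma vertex_subproof n (j : 'I_n.+1) :
  \row_k (k == j)%:R \in [set v : 'rV[R]_n.+1 |
    (forall i, 0 <= v ord0 i) /\ \sum_i v ord0 i = 1].
Proof.
apply/mem_set; split=> [i|]; first by rewrite mxE ler0n.
rewrite (bigD1 j) //= big1 ?mxE ?eqxx ?addr0 // => i /negbTE ij.
by rewrite mxE ij.
Qed.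

Definition vertex n (j : 'I_n.+1) : std_simplex R n := 
  exist _ (\row_k (k == j)%:R) (vertex_subproof j).

Lemma face_vertex n (i : 'I_n.+2) (j : 'I_n.+1) :
  face i (vertex j) = vertex (lift i j).
Proof.
apply: bary_inj; apply/rowP => k; rewrite !mxE.
case: unliftP => [l ->|->]; first by rewrite mxE (inj_eq lift_inj).
by rewrite (negbTE (neq_lift i j)).
Qed.

Lemma bary_face n (i : 'I_n.+2) (v : std_simplex R n) (k : 'I_n.+1) :
  bary (face i v) ord0 (lift i k) = bary v ord0 k.
Proof. by rewrite /bary /= mxE liftK. Qed.

Lemma bary_face_same n (i : 'I_n.+2) (v : std_simplex R n) :
  bary (face i v) ord0 i = 0.
Proof. by rewrite /bary /= mxE unlift_none. Qed.

Lemma edge_subproof (t : I) :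
  \row_k (if k == ord0 then 1 - ival t else ival t) \in [set v : 'rV[R]_2 |
    (forall i, 0 <= v ord0 i) /\ \sum_i v ord0 i = 1].
Proof.
have /andP[t0 t1] := ivalP t; apply/mem_set; split=> [i|].
  by rewrite mxE; case: eqP => _ //; rewrite subr_ge0.
by rewrite big_ord_recl big_ord1 !mxE /= subrK.
Qed.

Definition edge (t : I) : std_simplex R 1 := 
  exist _ (\row_k (if k == ord0 then 1 - ival t else ival t)) (edge_subproof t).

Lemma bary_edge (t : I) : bary (edge t) ord0 ord_max = ival t.
Proof. by rewrite /bary /= mxE. Qed.

Lemma bary_edge0 (t : I) : bary (edge t) ord0 ord0 = 1 - ival t.
Proof. by rewrite /bary /= mxE. Qed.

Lemma edge_bary (v : std_simplex R 1) : edge (clamp (bary v ord0 ord_max)) = v.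
Proof.
have [v0 v1] := baryP v; move: v1; rewrite big_ord_recl big_ord1.
have -> : lift ord0 (ord0 : 'I_1) = ord_max by exact: val_inj.
move=> v1; apply: bary_inj; apply/rowP => k; rewrite mxE ival_clamp; last first.
  by rewrite v0 -v1 lerDr v0.
case: (unliftP ord0 k) => [j ->|->]; last by rewrite eqxx -v1 addrK.
rewrite eq_sym (negbTE (neq_lift _ _)) (ord1 j).
by congr (bary v _ _); exact: val_inj.
Qed.

Lemma edge_continuous : continuous edge.
Proof.
apply: simplex_valued_continuous => i.
have -> : (fun z => bary (edge z) ord0 i)
    = (fun t => if i == ord0 then 1 - ival t else ival t).
  by apply/funext => t; rewrite /bary /= mxE.
case: (i == ord0); last exact: ival_continuous.
apply: contB; [exact: cst_continuous|exact: ival_continuous].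
Qed.

Lemma edge0 : edge zero = vertex ord0.
Proof.
apply: bary_inj; apply/rowP => k; rewrite !mxE ival0.
by case: eqP; rewrite ?subr0.
Qed.

Lemma edge1 : edge one = vertex ord_max.
Proof.
apply: bary_inj; apply/rowP => k; rewrite !mxE ival1.
case: (unliftP ord0 k) => [j ->|->]; last by rewrite eqxx subrr.
by rewrite (ord1 j).
Qed.

Lemma mix_subproof n (t : I) (v w : std_simplex R n) :
  (1 - ival t) *: bary v + ival t *: bary w \in [set v : 'rV[R]_n.+1 |
    (forall i, 0 <= v ord0 i) /\ \sum_i v ord0 i = 1].
Proof.
have /andP[t0 t1] := ivalP t; have [v0 v1] := baryP v; have [w0 w1] := baryP w.
apply/mem_set; split=> [i|].
  by rewrite !mxE addr_ge0 // mulr_ge0 // subr_ge0.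
under eq_bigr do rewrite !mxE.
by rewrite big_split /= -!mulr_sumr v1 w1 !mulr1 subrK.
Qed.

Definition mix n (t : I) (v w : std_simplex R n) : std_simplex R n :=
  exist _ ((1 - ival t) *: bary v + ival t *: bary w) (mix_subproof t v w).

(** Standard simplices are convex: the straight line homotopy works. *)
Lemma simplex_path_homotopic n (x y : std_simplex R n)
    (f g : {path I from x to y}) :
  path_homotopic f g.
Proof.
exists (fun st => mix st.2 (f st.1) (g st.1)); split=> [|s|s|t|t].
- apply: simplex_valued_continuous => i.
  have -> : (fun z : I * I => bary (mix z.2 (f z.1) (g z.1)) ord0 i)
      = (fun z => (1 - ival z.2) * bary (f z.1) ord0 i
                  + ival z.2 * bary (g z.1) ord0 i).
    by apply/funext => z; rewrite /bary /= !mxE.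
  have c2 : continuous (fun z : I * I => ival z.2).
    by apply: cont_ival; exact: cont_snd.
  have cb (h : {path I from x to y}) :
      continuous (fun z : I * I => bary (h z.1) ord0 i).
    apply: (@cont_comp _ _ _ (fun v => bary v ord0 i)).
      exact: bary_continuous.
    by apply: cont_comp; [exact: cts_fun|exact: cont_fst].
  apply: contD; apply: contM => //.
  by apply: contB => //; exact: cst_continuous.
- by apply: bary_inj; rewrite /bary /= ival0 subr0 scale1r scale0r addr0.
- by apply: bary_inj; rewrite /bary /= ival1 subrr scale1r scale0r add0r.
- by apply: bary_inj; rewrite /= !path_zero /bary /= -scalerDl subrK scale1r.
- by apply: bary_inj; rewrite /= !path_one /bary /= -scalerDl subrK scale1r.
Qed.

Lemma face_edge_cts (i : 'I_3) : continuous (fun t => face i (edge t)).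
Proof. exact: cont_comp (@face_continuous R 1 i) edge_continuous. Qed.

Lemma face_edge0 (i : 'I_3) : face i (edge zero) = vertex (lift i ord0).
Proof. by rewrite edge0 face_vertex. Qed.

Lemma face_edge1 (i : 'I_3) : face i (edge one) = vertex (lift i ord_max).
Proof. by rewrite edge1 face_vertex. Qed.

Definition face_path (i : 'I_3) (a b : 'I_3) (ia : lift i ord0 = a)
    (ib : lift i ord_max = b) : {path I from vertex a to vertex b} :=
  mk_path (@face_edge_cts i) (etrans (face_edge0 i) (congr1 (@vertex 2) ia))
    (etrans (face_edge1 i) (congr1 (@vertex 2) ib)).

End StandardSimplex.

(** * Paths as relative chains *)

Section PathChains.
Context {R : realType} {Y : topologicalType} (B : set Y).
Local Open Scope ring_scope.
Local Notation I := (I01 R).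

Definition chain_class : chain R Y 1 -> coker (@rel_bd R Y B 2) :=
  @coker_pi _ _ (@rel_bd R Y B 2) \o @rel_pi R Y B 1.
HB.instance Definition _ := GRing.Additive.on chain_class.

Lemma chain_class_bd (d : chain R Y 2) : chain_class (chain_bdS d) = 0.
Proof.
by apply/coker_pi_eq0; exists (rel_pi B d); exact: (@rel_bdE R Y B 2 d).
Qed.

Definition path_chain_class x y (f : {path I from x to y}) :=
  chain_class << path_simplex f >>.

Lemma path_chain_class_ext x y x' y' (f : {path I from x to y})
    (g : {path I from x' to y'}) :
  f =1 g -> path_chain_class f = path_chain_class g.
Proof.
move=> fg; rewrite /path_chain_class; congr (chain_class << _ >>).
by apply/continuousEP => v; exact: fg.
Qed.

Lemma simplex_bd1E (s : simplex R Y 1) :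
  chain_bdS << s >> = << simplex_face ord0 s >> - << simplex_face ord_max s >>.
Proof.
rewrite chain_bdSU /simplex_bd big_ord_recl big_ord1 /= expr0 scale1r.
by rewrite expr1 scaleN1r; congr (_ - << simplex_face _ s >>); exact: val_inj.
Qed.

Lemma simplex_bd2E (s : simplex R Y 2) :
  chain_bdS << s >> =
    << simplex_face ord0 s >> - << simplex_face (@inord 2 1) s >>
      + << simplex_face ord_max s >>.
Proof.
rewrite chain_bdSU /simplex_bd !big_ord_recl big_ord0 /= expr0 scale1r addr0.
rewrite /bump /= expr1 scaleN1r sqrrN expr1n scale1r addrA.
by congr (_ - << simplex_face _ s >> + << simplex_face _ s >>);
  apply: val_inj => //=; rewrite inordK.
Qed.

(** The relation given by the boundary of a singular triangle.  Its map is
    written as a function [K] of the second and third barycentric coordinates,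
    so the vertices are [(0, 0)], [(1, 0)] and [(0, 1)]; [K] is defined on the
    whole plane so that its continuity does not mention the simplex. *)
Lemma triangle_class (K : R * R -> Y) x y z (f : {path I from x to y})
    (g : {path I from y to z}) (h : {path I from x to z}) :
  continuous K -> (forall t, f t = K (ival t, 0)) ->
  (forall t, g t = K (1 - ival t, ival t)) -> (forall t, h t = K (0, ival t)) ->
  path_chain_class h = path_chain_class f + path_chain_class g.
Proof.
move=> cK fK gK hK.
pose i1 : 'I_3 := @inord 2 1.
have cs : continuous (fun v : std_simplex R 2 =>
    K (bary v ord0 i1, bary v ord0 ord_max)).
  by apply: cont_comp => //; apply: cont_pair; exact: bary_continuous.
pose s : simplex R Y 2 := mkcts cs.
have faceE i x' y' (k : {path I from x' to y'}) :
    (forall t, k t = s (face i (edge t))) -> simplex_face i s = path_simplex k.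
  move=> ks; apply/continuousEP => v /=; rewrite -{1}(edge_bary v) -ks.
  by [].
have sE i a b (t : I) : bary (face i (edge t)) ord0 i1 = a ->
    bary (face i (edge t)) ord0 ord_max = b -> s (face i (edge t)) = K (a, b).
  by move=> <- <-.
have l01 : i1 = lift (ord0 : 'I_3) (ord0 : 'I_2)
  by apply: val_inj; rewrite /= inordK.
have l02 : ord_max = lift (ord0 : 'I_3) (ord_max : 'I_2) by exact: val_inj.
have l12 : ord_max = lift i1 (ord_max : 'I_2)
  by apply: val_inj; rewrite /= inordK.
have l21 : i1 = lift (ord_max : 'I_3) (ord_max : 'I_2).
  by apply: val_inj; rewrite /= inordK.
have := chain_class_bd << s >>; rewrite simplex_bd2E raddfD raddfB /=.
have -> : simplex_face ord0 s = path_simplex g.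
  apply: faceE => t; rewrite gK; apply/esym/sE.
    by rewrite {1}l01 bary_face bary_edge0.
  by rewrite {1}l02 bary_face bary_edge.
have -> : simplex_face (inord 1) s = path_simplex h.
  apply: faceE => t; rewrite hK; apply/esym/sE; first exact: bary_face_same.
  by rewrite {1}l12 bary_face bary_edge.
have -> : simplex_face ord_max s = path_simplex f.
  apply: faceE => t; rewrite fK; apply/esym/sE; last exact: bary_face_same.
  by rewrite {1}l21 bary_face bary_edge.
rewrite addrAC addrC => /eqP; rewrite addrC subr_eq0 addrC => /eqP fgh.
by rewrite /path_chain_class -fgh.
Qed.

(** The triangle whose edge opposite the middle vertex runs along the
    concatenation; it is constant on the lines joining that edge to the
    corresponding points of the other two. *)
Lemma path_chain_class_cat x y z (f : {path I from x to y})
    (g : {path I from y to z}) :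
  path_chain_class (path_cat f g) = path_chain_class f + path_chain_class g.
Proof.
apply: (@triangle_class (fun ab => path_cat f g (clamp (ab.2 + 2^-1 * ab.1)))).
- apply: cont_comp; first exact: cts_fun.
  apply: cont_clamp; apply: contD; first exact: cont_snd.
  by apply: contM; [exact: cst_continuous|exact: cont_fst].
- move=> t; have /andP[t0 t1] := ivalP t.
  rewrite /= /mk_path /path_cat_fun /= add0r ival_clamp; last first.
    by apply/andP; split; lra.
  rewrite ifT; last by lra.
  by rewrite mulrA divff ?pnatr_eq0 // mul1r clampK.
- move=> t; have /andP[t0 t1] := ivalP t.
  rewrite /= /mk_path /path_cat_fun /= ival_clamp; last first.
    by apply/andP; split; lra.
  case: ifP => th.
    have t00 : ival t = 0 by lra.
    have -> : t = zero by apply: ival_inj; rewrite t00 ival0.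
    by rewrite ival0 path_zero clamp1 ?path_one //; lra.
  by rewrite -{1}[t]clampK; congr (g (clamp _)); lra.
- by move=> t; rewrite /= mulr0 addr0 clampK.
Qed.

(** A constant path is its own square. *)
Lemma path_chain_class_cst x y (f : {path I from x to y}) :
  (forall t, f t = x) -> path_chain_class f = 0.
Proof.
move=> fx.
have fE : path_chain_class f = path_chain_class (path_cst (R := R) x).
  exact: path_chain_class_ext.
apply: (addrI (path_chain_class f)).
rewrite addr0 {1 2}fE -path_chain_class_cat.
apply: path_chain_class_ext => t.
by rewrite fx /= /mk_path /path_cat_fun /=; case: ifP.
Qed.

(** The square of the homotopy is cut along its diagonal into two triangles,
    each having one constant side. *)
Lemma path_chain_class_homotopic x y (f g : {path I from x to y}) :
  path_homotopic f g -> path_chain_class f = path_chain_class g.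
Proof.
move=> [H [cH Hf Hg Hx Hy]].
have c1 : continuous (fun ab : R * R => clamp ab.1 : I)
  by apply: cont_clamp; exact: cont_fst.
have c2 : continuous (fun ab : R * R => clamp ab.2 : I)
  by apply: cont_clamp; exact: cont_snd.
have c12 : continuous (fun ab : R * R => clamp (ab.1 + ab.2) : I).
  by apply: cont_clamp; apply: contD; [exact: cont_fst|exact: cont_snd].
have cd : continuous (fun t => H (t, t)).
  by apply: cont_comp => //; apply: cont_pair => t; exact: cvg_id.
have dx : H (zero, zero) = x by [].
have dy : H (one, one) = y by [].
pose d : {path I from x to y} := mk_path cd dx dy.
have -> : path_chain_class f = path_chain_class d.
  rewrite (@triangle_class (fun ab => H (clamp (ab.1 + ab.2), clamp ab.2)) _ _ _
    f (path_cst y) d).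
  - by rewrite (path_chain_class_cst (f := path_cst y)) // addr0.
  - by apply: cont_comp => //; exact: cont_pair.
  - by move=> t; rewrite /= addr0 clampK clamp0 // Hf.
  - by move=> t; rewrite /= subrK clamp1 // Hy.
  - by move=> t; rewrite /= add0r clampK.
rewrite (@triangle_class (fun ab => H (clamp ab.2, clamp (ab.1 + ab.2))) _ _ _
    (path_cst x) g d).
- by rewrite (path_chain_class_cst (f := path_cst x)) // add0r.
- by apply: cont_comp => //; exact: cont_pair.
- by move=> t; rewrite /= addr0 clampK clamp0 // Hx.
- by move=> t; rewrite /= subrK clampK [X in H (_, X)]clamp1 // Hg.
- by move=> t; rewrite /= add0r clampK.
Qed.

Lemma path_chain_class_rev x y (f : {path I from x to y}) :
  path_chain_class (path_rev f) = - path_chain_class f.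
Proof.
apply: (addrI (path_chain_class f)); rewrite subrr -path_chain_class_cat.
rewrite (@path_chain_class_homotopic _ _ _ (path_cst x)).
  exact: path_chain_class_cst.
by apply/path_classP; rewrite -pc_compE -pc_invE pc_compV.
Qed.

End PathChains.

(** * Relative homology and the total abelianisation *)

Section TotabHomology.
Context {R : realType} {Y : topologicalType} (B : set Y).
Local Open Scope ring_scope.
Local Open Scope quotient_scope.
Local Notation I := (I01 R).
Local Notation PB := (fund_groupoid R B).
Local Notation H1 := (sing_homology R B 1).
Local Notation h1 :=
  (@homology_coker _ _ _ (@rel_bd R Y B 2) (@rel_bd R Y B 1)).
Local Notation h1_inj :=
  (@homology_coker_inj _ _ _ (@rel_bd R Y B 2) (@rel_bd R Y B 1)).
Local Notation pcc := (path_chain_class B).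

Hypothesis B_meets :
  forall y : Y, exists b : B, inhabited {path I from y to \val b}.
Hypothesis B_const : forall x y (f : {path I from x to y}),
  (forall t, B (f t)) -> forall t, f t = x.

Lemma homology_coker_path (a b : B) (f : {path I from \val a to \val b}) :
  h1 (path_cycle f) = pcc f.
Proof. exact: homology_cokerE. Qed.

Lemma path_cycle_homotopic (a b : B) (f g : {path I from \val a to \val b}) :
  path_homotopic f g -> path_cycle f = path_cycle g.
Proof.
move=> fg; apply: h1_inj.
by rewrite !homology_coker_path; exact: path_chain_class_homotopic.
Qed.

Definition arrow_cycle (x : arrow PB) : H1 :=
  path_cycle (repr (ahom x : path_class R (\val (asrc x)) (\val (atgt x)))).

Lemma arrow_cycleE (a b : B) (f : {path I from \val a to \val b}) :
  arrow_cycle (@Arrow PB a b (pcl f)) = path_cycle f.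
Proof. exact/path_cycle_homotopic/path_homotopic_repr. Qed.

Lemma arrow_cycle_to_abelian : to_abelian arrow_cycle.
Proof.
move=> a b c u v; have [f ->] := pclP u; have [g ->] := pclP v.
rewrite /= pc_compE !arrow_cycleE.
apply: h1_inj.
by rewrite raddfD /= !homology_coker_path path_chain_class_cat.
Qed.

Definition totab_homology : totab PB -> H1 := totab_lift arrow_cycle_to_abelian.
HB.instance Definition _ := GRing.Additive.on totab_homology.

Lemma totab_homologyE (a b : B) (f : {path I from \val a to \val b}) :
  totab_homology (totab_in (@Arrow PB a b (pcl f))) = path_cycle f.
Proof. by rewrite /totab_homology totab_liftE arrow_cycleE. Qed.

(** The connecting path is taken constant over [B]; this normalisation makes the
    inverse isomorphism vanish on chains of [B]. *)
Lemma connector_exists (y : Y) :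
  exists b : B, exists g : {path I from y to \val b}, B y -> forall t, g t = y.
Proof.
have [By|nBy] := pselect (B y); last first.
  by have [b [g]] := B_meets y; exists b, g.
by have yB : y \in B := mem_set By; exists (exist _ y yB), (path_cst y).
Qed.

Definition connect_end (y : Y) : B := sval (cid (connector_exists y)).
Definition connector (y : Y) : {path I from y to \val (connect_end y)} :=
  sval (cid (svalP (cid (connector_exists y)))).

Lemma connector_const (y : Y) : B y -> forall t, connector y t = y.
Proof. exact: (svalP (cid (svalP (cid (connector_exists y))))). Qed.

Local Notation gam y := (pcl (connector y)).

(** A path with arbitrary end points is closed up by connecting paths. *)
Definition class_totab x y (u : path_class R x y) : totab PB :=
  totab_in (@Arrow PB (connect_end x) (connect_end y)
    (pc_comp (pc_inv (gam x)) (pc_comp u (gam y)))).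

Lemma class_totab_comp x y z (u : path_class R x y) (v : path_class R y z) :
  class_totab (pc_comp u v) = class_totab u + class_totab v.
Proof.
rewrite /class_totab -(totab_in_comp (H := PB)); congr (totab_in (Arrow _)).
rewrite /= -!pc_compA; congr pc_comp; congr pc_comp.
by rewrite !pc_compA pc_compV pc_id_comp.
Qed.

Lemma totab_in_const (a b : B) (f : {path I from \val a to \val b}) :
  (forall t, f t = \val a) -> totab_in (@Arrow PB a b (pcl f)) = 0.
Proof.
move=> fa; have ab : b = a by apply: val_inj; rewrite -(path_one (s := f)) fa.
case: _ / (esym ab) f fa => f fa.
rewrite (_ : f = path_cst (\val a)); last exact/path_eqP.
exact: (to_abelian_id (@totab_in_comp PB) (a : PB)).
Qed.

(** Connecting paths at points of [B] are constant and contribute zero. *)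
Lemma class_totab_base (a b : B) (u : path_class R (\val a) (\val b)) :
  class_totab u = totab_in (@Arrow PB a b u).
Proof.
have gam0 (c : B) :
    totab_in (@Arrow PB c (connect_end (\val c)) (gam (\val c))) = 0.
  by apply: totab_in_const => t; exact: connector_const (set_valP c) t.
rewrite /class_totab.
have totM := @totab_in_comp PB.
rewrite (totM (connect_end (\val a)) a (connect_end (\val b))
  (pc_inv _) (pc_comp _ _)).
rewrite (totM a b (connect_end (\val b)) u _) gam0 addr0.
rewrite (to_abelian_inv totM
  (gam (\val a) : @ghom PB a (connect_end (\val a)))).
by rewrite gam0 oppr0 add0r.
Qed.

Lemma class_totab_ext x y x' y' (f : {path I from x to y})
    (g : {path I from x' to y'}) :
  f =1 g -> class_totab (pcl f) = class_totab (pcl g).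
Proof.
move=> fg; have ex : x = x' by rewrite -(path_zero (s := f)) fg path_zero.
have ey : y = y' by rewrite -(path_one (s := f)) fg path_one.
case: _ / ex f g fg => f; case: _ / ey f => f g fg.
by congr (class_totab (pcl _)); exact/path_eqP.
Qed.

Lemma simplex_path_cts (s : simplex R Y 1) :
  continuous (fun t : I => s (edge t)).
Proof. by apply: cont_comp; [exact: cts_fun|exact: edge_continuous]. Qed.

Definition simplex_path (s : simplex R Y 1) :
    {path I from s (edge zero) to s (edge one)} :=
  mk_path (@simplex_path_cts s) erefl erefl.

Lemma simplex_pathK (s : simplex R Y 1) : path_simplex (simplex_path s) = s.
Proof. by apply/continuousEP => v /=; rewrite -{2}(edge_bary v). Qed.

Definition simplex_totab (s : simplex R Y 1) : totab PB :=
  class_totab (pcl (simplex_path s)).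

Lemma simplex_totab_path x y (f : {path I from x to y}) :
  simplex_totab (path_simplex f) = class_totab (pcl f).
Proof.
apply: class_totab_ext => t.
by rewrite /= /mk_path /path_simplex /mkcts bary_edge clampK.
Qed.

Lemma simplex_totab_sub (s : simplex R Y 1) :
  (forall v, B (s v)) -> simplex_totab s = 0.
Proof.
move=> Bs; have bP v : s v \in B by exact: mem_set.
pose a : B := exist _ (s (edge zero)) (bP (edge zero)).
pose b : B := exist _ (s (edge one)) (bP (edge one)).
rewrite /simplex_totab (class_totab_base (a := a) (b := b)).
by apply: totab_in_const; apply: B_const => t; exact: Bs.
Qed.

Definition chain_totab : chain R Y 1 -> totab PB := free_lift simplex_totab.
HB.instance Definition _ := GRing.Additive.on chain_totab.

Lemma chain_totab_sub c : c \in subchain B (n := 1) -> chain_totab c = 0.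
Proof.
move=> /asboolP cB; apply: free_lift_eq0 => s sc.
by apply: simplex_totab_sub; exact: cB.
Qed.

(** The three edges of a singular 2-simplex are the images of the edges of the
    standard triangle, where the composite of two is homotopic to the third. *)
Lemma chain_totab_bd (d : chain R Y 2) : chain_totab (chain_bdS d) = 0.
Proof.
apply: (@freeg_ext _ _ (chain_totab \o @chain_bdS R Y 1) \0) => s.
rewrite /= simplex_bd2E raddfD raddfB /= /chain_totab !free_liftU.
have cs : continuous s by exact: cts_fun.
have l01 : lift (ord0 : 'I_3) (ord0 : 'I_2) = inord 1
  by apply: val_inj; rewrite /= inordK.
have l02 : lift (ord0 : 'I_3) (ord_max : 'I_2) = ord_max by exact: val_inj.
have l10 : lift (inord 1 : 'I_3) (ord0 : 'I_2) = ord0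
  by apply: val_inj; rewrite /= inordK.
have l12 : lift (inord 1 : 'I_3) (ord_max : 'I_2) = ord_max
  by apply: val_inj; rewrite /= inordK.
have l20 : lift (ord_max : 'I_3) (ord0 : 'I_2) = ord0 by apply: val_inj.
have l21 : lift (ord_max : 'I_3) (ord_max : 'I_2) = inord 1.
  by apply: val_inj; rewrite /= inordK.
pose f01 := face_path (R := R) l20 l21; pose f12 := face_path (R := R) l01 l02.
pose f02 := face_path (R := R) l10 l12.
pose P a b (f : {path I from a to b}) :=
  Defs.path_map cs (erefl (s a)) (erefl (s b)) f.
have faceE (i a b : 'I_3) (ia : lift i (ord0 : 'I_2) = a)
    (ib : lift i (ord_max : 'I_2) = b) :
  simplex_totab (simplex_face i s)
  = class_totab (pcl (P _ _ (face_path ia ib))).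
  exact: class_totab_ext.
rewrite (faceE _ _ _ l01 l02) (faceE _ _ _ l10 l12) (faceE _ _ _ l20 l21).
have h02 : pcl (path_cat f01 f12) = pcl f02
  by apply/path_classP; exact: simplex_path_homotopic.
have -> : pcl (P _ _ f02) = pc_comp (pcl (P _ _ f01)) (pcl (P _ _ f12)).
  by rewrite -pc_mapE -h02 -pc_compE (pc_map_comp cs _ erefl) !pc_mapE.
by rewrite class_totab_comp addrAC [X in X - _]addrC subrr.
Qed.

Definition rel_chain_totab : rel_chain R B 1 -> totab PB :=
  zquot_lift chain_totab_sub.
HB.instance Definition _ := GRing.Additive.on rel_chain_totab.

Lemma rel_chain_totabE c : rel_chain_totab (rel_pi B c) = chain_totab c.
Proof. exact: (zquot_liftE chain_totab_sub). Qed.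

Lemma cycle_totab_subproof (z : cycles (@rel_bd R Y B 1)) :
  z \in boundaries (@rel_bd R Y B 2) (g := @rel_bd R Y B 1) ->
  (rel_chain_totab \o \val) z = 0.
Proof.
rewrite unfold_in => /asboolP[a /= <-]; move: a; elim/quotW => d.
rewrite [@rel_bd _ _ _ _ _](@rel_bdE R Y B 2 d) rel_chain_totabE.
exact: chain_totab_bd.
Qed.

Definition homology_totab : H1 -> totab PB := zquot_lift cycle_totab_subproof.
HB.instance Definition _ := GRing.Additive.on homology_totab.

Lemma homology_totabE z : homology_totab (\pi_H1 z) = rel_chain_totab (\val z).
Proof. exact: (zquot_liftE cycle_totab_subproof). Qed.

Lemma totab_homologyK : cancel totab_homology homology_totab.
Proof.
apply: (@totab_ext _ _ (homology_totab \o totab_homology) idfun)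
  => // [|[a b u]].
  exact: raddfB.
have [f ->] := pclP u.
rewrite /= totab_homologyE homology_totabE rel_chain_totabE.
by rewrite /chain_totab free_liftU simplex_totab_path class_totab_base.
Qed.

(** A singular 0-simplex is identified with its value at the only point of its
    domain. *)
Definition connector_chain : chain R Y 0 -> coker (@rel_bd R Y B 2) :=
  free_lift (fun s : simplex R Y 0 => pcc (connector (s (vertex ord0)))).
HB.instance Definition _ := GRing.Additive.on connector_chain.

(** A chain homotopy formula: replacing each simplex by its closed up path
    changes the chain by the connecting paths over its boundary. *)
Lemma totab_homology_chain (c : chain R Y 1) :
  h1 (totab_homology (chain_totab c))
  = chain_class B c + connector_chain (chain_bdS c).
Proof.
apply: (@freeg_ext _ _ (h1 \o totab_homology \o chain_totab)
  (chain_class B \+ (connector_chain \o @chain_bdS R Y 0))) => s.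
rewrite /= simplex_bd1E raddfB /= /connector_chain !free_liftU /=.
rewrite {1}/chain_totab free_liftU /simplex_totab /class_totab pc_invE !pc_compE.
rewrite totab_homologyE homology_coker_path.
rewrite !path_chain_class_cat path_chain_class_rev.
have -> : pcc (simplex_path s) = chain_class B << s >>.
  by rewrite /path_chain_class simplex_pathK.
have -> : face ord0 (vertex ord0) = edge (one : I).
  by rewrite edge1 face_vertex; congr vertex; exact: val_inj.
have -> : face ord_max (vertex ord0) = edge (zero : I).
  by rewrite edge0 face_vertex; congr vertex; exact: val_inj.
by rewrite addrCA [X in _ + X]addrC.
Qed.

Lemma homology_totabK : cancel homology_totab totab_homology.
Proof.
elim/quotW => z; apply: h1_inj.
rewrite homology_totabE homology_cokerE.
case: z => z /=; move: z; elim/quotW => c zc.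
rewrite [rel_chain_totab _](rel_chain_totabE c) totab_homology_chain.
rewrite [X in _ + X](_ : _ = 0) ?addr0 //.
apply: free_lift_eq0 => s sc; apply: path_chain_class_cst; apply: connector_const.
move: zc; rewrite unfold_in => /eqP; rewrite [LHS](@rel_bdE R Y B 1 c).
by move=> /rel_pi_eq0 /asboolP; apply.
Qed.

Lemma totab_homology_iso : exists z : zmod_iso (totab PB) H1,
  forall (a b : B) (f : {path I from \val a to \val b}),
    z (totab_in (@Arrow PB a b (pcl f))) = path_cycle f.
Proof.
exists (ZmodIso (@raddfB _ _ totab_homology) totab_homologyK homology_totabK).
exact: totab_homologyE.
Qed.

End TotabHomology.

(** * The covering space *)

Section Fibre.
Context {R : realType} {E X : topologicalType}.
Variables (p : E -> X) (hp : covering_map p).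
Variable (x : X).

(** A path in the fibre lifts a constant path, and so does the constant path
    at its starting point. *)
Lemma fiber_path_const a b (f : {path (I01 R) from a to b}) :
  (forall t, (p @^-1` [set x]) (f t)) -> forall t, f t = a.
Proof.
move=> fx; apply: (@path_lift_unique R _ _ _ hp f (fun=> a)).
- exact: cts_fun.
- exact: cst_continuous.
- by move=> t; have := fx zero; rewrite path_zero => /= ->; exact: fx.
- exact: path_zero.
Qed.

(** A loop at [x] fixes a point of the fibre exactly when it lifts to a loop at
    that point. *)
Lemma determined_by_stabilizer (N : normal_subgroup (pi1 R x)) :
  determined_by hp.1 N ->
  exists e : p @^-1` [set x], forall u, N u <-> fiber_act hp u e = e.
Proof.
move=> [e [pe eN]]; have eX0 : e \in p @^-1` [set x] by exact: mem_set.
pose e0 : p @^-1` [set x] := exist _ e eX0; exists e0 => u.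
rewrite eN (Prop_irrelevance pe (set_valP e0)); split=> [[v <-]|ue].
  exact: (@fiber_actE _ _ _ _ hp x e0 e0 v).
by move: (fiber_actP hp u e0); rewrite ue.
Qed.

End Fibre.

Theorem theorem5p9 (R : realType) (X Xhat : topologicalType) (p : Xhat -> X)
    (hp : covering_map p)
    (hX : path_connected R X) (hXhat : path_connected R Xhat)
    (x : X) (N : normal_subgroup (pi1 R x)) (hN : determined_by hp.1 N) :
  let phi := @quot_mor (pi1 R x) N in
  let X0 := p @^-1` [set x] in
  let H1 := sing_homology R X0 1 in
  exists Theta : gfunctor (Fhat phi) (fund_groupoid R X0),
    [/\ groupoid_iso Theta,
        forall (a b : Fhat phi) (u : ghom a b),
          pc_map hp.1 (set_valP (Theta a)) (set_valP (Theta b)) (fhom Theta u)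
          = Fhat_proj u &
        exists zeta : zmod_iso (totab (Fhat phi)) H1,
          (forall (a b : Fhat phi) (u : ghom a b)
             (f : {path (I01 R) from \val (Theta a) to \val (Theta b)}),
             fhom Theta u = pcl f ->
             zeta (totab_in (Arrow u)) = path_cycle f) /\
          exists d : pi1 R x -> H1,
            @universal_derivation _ _ phi
              (@transport_module _ (Fhat_module phi) H1 zeta) d].
Proof.
move=> phi X0 H1; have [e eN] := determined_by_stabilizer hN.
have isoT := theta_iso hXhat eN.
exists (theta eN); split=> //; first exact: theta_homE.
have [y yE] := totab_iso_exists isoT.
have X0_meets (b : Xhat) :
    exists a : X0, inhabited {path (I01 R) from b to \val a}.
  by exists e; exact: hXhat.
have [z zE] := totab_homology_iso X0_meets (fiber_path_const hp (x := x)).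
have [t tE] := zmod_iso_comp y z; exists t; split.
  move=> a b u f uf; rewrite tE yE /map_arrow uf; exact: zE.
exists (t \o (fun u => totab_in (Fhat_arrow phi u 1%g))).
exact: (transport_universal_derivation (M := Fhat_module phi) t
  (totab_universal_derivation phi)).
Qed.
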